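(* Let $T^{\mathcal F}$ be a maximally modulated singular integral operator on $\mathbb{R}^n$ which is sub-linear. Let $1\le q,r<\infty$ and $\alpha\ge 3$. Suppose that $T^{\mathcal F}$ satisfies the $W_q$ property, with associated function $\psi_{T^{\mathcal F},q}$, and that $M^{\sharp}_{T^{\mathcal F},\alpha}$ is of weak type $(r,r)$. Let $s=\max(q,r)$. Then, for every compactly supported $f\in L^s(\mathbb{R}^n)$, there exists a $\frac{1}{2\alpha^n}$-sparse family $\mathcal S$ of cubes such that $$|T^{\mathcal F}f(x)|\le C\sum_{Q\in\mathcal S}\langle f\rangle_{s,Q}\,\chi_Q(x)\qquad\text{for a.e. }x\in\mathbb{R}^n,$$ where $$C=c_{n,r,s,\alpha}\left(\psi_{T^{\mathcal F},q}\!\left(\frac{1}{12(2\alpha)^n}\right)+\big\|M^{\sharp}_{T^{\mathcal F},\alpha}\big\|_{L^r\to L^{r,\infty}}\right)$$ and $c_{n,r,s,\alpha}$ is a constant depending only on $n,r,s,\alpha$.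
   Context: Cubes are cubes in $\mathbb{R}^n$ with sides parallel to the axes; $\alpha Q$ is the cube concentric with $Q$ with side length $\alpha$ times that of $Q$; $|E|$ is Lebesgue measure, and $\chi_E$ is the indicator function of $E$. Maximally modulated operator. $T$ is a linear operator of weak type $(1,1)$ such that $Tf(x)=\int_{\mathbb{R}^n}K(x,y)f(y)\,dy$ for $x\notin\operatorname{supp}f$, where the kernel $K$ satisfies the $L^{\rho}$-Hörmander condition for some exponent $\rho\in[1,\infty]$: $$\sup_{Q}\ \sup_{x',x''\in\frac12Q}\ \sum_{k=1}^\infty|2^kQ|^{1/\rho'}\,\|K(x',\cdot)-K(x'',\cdot)\|_{L^{\rho}(2^kQ\setminus2^{k-1}Q)}<\infty,$$ with $\rho'$ the conjugate exponent of $\rho$. Let $\mathcal F=\{\phi_\theta\}_{\theta\in A}$ be a family of real-valued measurable functions on $\mathbb{R}^n$ indexed by a set $A$. With $\mathcal M^{\phi_\theta}f(x)=e^{2\pi i\phi_\theta(x)}f(x)$, define $$T^{\mathcal F}f(x)=\sup_{\theta\in A}|T(\mathcal M^{\phi_\theta}f)(x)|.$$ Averages: $\langle f\rangle_{p,Q}=\left(\frac1{|Q|}\int_Q|f|^p\right)^{1/p}$. $W_q$ property: a sub-linear operator $U$ satisfies $W_q$ if there is a non-increasing function $\psi_{U,q}$ on $(0,1)$ such that for every cube $Q$, every $f\in L^q(Q)$ and every $0<\lambda<1$, $$\left|\{x\in Q:|U(f\chi_Q)(x)|>\psi_{U,q}(\lambda)\langle f\rangle_{q,Q}\}\right|\le\lambda|Q|.$$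 Sharp maximal operator: for $\alpha\ge3$, $$M^{\sharp}_{T^{\mathcal F},\alpha}f(x)=\sup_{Q\ni x}\ \operatorname*{ess\,sup}_{x',x''\in Q}\left|T^{\mathcal F}(f\chi_{\mathbb{R}^n\setminus\alpha Q})(x')-T^{\mathcal F}(f\chi_{\mathbb{R}^n\setminus\alpha Q})(x'')\right|,$$ the supremum being over all cubes $Q$ containing $x$. It is of weak type $(r,r)$ if it is bounded from $L^r$ to $L^{r,\infty}$, with norm $\|M^{\sharp}_{T^{\mathcal F},\alpha}\|_{L^r\to L^{r,\infty}}$. Sparse family: a family $\mathcal S$ of cubes is $\eta$-sparse ($0<\eta\le 1$) if there exist pairwise disjoint measurable sets $E_Q\subset Q$, $Q\in\mathcal S$, with $|E_Q|\ge\eta|Q|$. *)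

(* Defs.v *)
From HB Require Import structures.
From mathcomp Require Import all_boot all_order all_algebra.
From mathcomp Require Import complex.
From mathcomp Require Import all_classical all_reals all_analysis.
From mathcomp Require Import ess_sup_inf lra.
Set Implicit Arguments.
Unset Strict Implicit.
Unset Printing Implicit Defensive.
Import Order.TTheory GRing.Theory Num.Theory.
Import numFieldNormedType.Exports.
Local Open Scope classical_set_scope.
Local Open Scope ring_scope.
Local Open Scope ereal_scope.

(* R^n, with the Euclidean topology and, below, the Lebesgue sigma-algebra. *)
Definition Rn (R : realType) (n : nat) : Type := 'rV[R]_n.

HB.instance Definition _ (R : realType) (n : nat) :=
  NormedModule.on (Rn R n).

Section lebesgue_outer_measure.
Context {R : realType} {n : nat}.
Implicit Types (A X : set (Rn R n)) (b : option (Rn R n * Rn R n)).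

(* [Some (u, v)] encodes the half-open box \prod_i [u_i, v_i[ and [None] the
   empty set, so that sequences of boxes range over the countable, possibly
   finite, families of boxes. *)
Definition box b : set (Rn R n) :=
  if b is Some (u, v)
  then [set x | forall i, (u 0 i <= x 0 i < v 0 i)%R] else set0.

Definition box_volume b : \bar R :=
  if b is Some (u, v) then (\prod_i Num.max 0 (v 0 i - u 0 i))%:E else 0.

Definition box_cover A : set (option (Rn R n * Rn R n))^nat :=
  [set B | A `<=` \bigcup_k box (B k)].

(* Lebesgue measure, as a function on all subsets of R^n (outer measure). *)
Definition leb A : \bar R :=
  ereal_inf [set \sum_(k <oo) box_volume (B k) | B in box_cover A].

Lemma box_volume_ge0 b : 0 <= box_volume b.
Proof.
by case: b => [[u v]|]//=; rewrite lee_fin prodr_ge0// => i _; rewrite le_max lexx.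
Qed.

#[local] Hint Resolve box_volume_ge0 : core.

Let leb_ge0 A : 0 <= leb A.
Proof. by apply: le_ereal_inf_tmp => _ [B _ <-]; exact: nneseries_ge0. Qed.

Let le_leb : {homo leb : A X / A `<=` X >-> A <= X}.
Proof.
move=> A X AX; apply/ereal_inf_le_tmp => _ [B BX <-]; exists B => //.
exact: subset_trans AX BX.
Qed.

Let leb0 : leb set0 = 0.
Proof.
apply/eqP; rewrite eq_le leb_ge0 andbT; apply: ereal_inf_lbound.
by exists (fun=> None) => //=; rewrite eseries0.
Qed.

Let leb_sigma_subadditive : sigma_subadditive leb.
Proof.
move=> A; have [[i ioo]|] := pselect (exists i, leb (A i) = +oo).
  by rewrite (eseries_pinfty _ _ ioo) ?leey// => k _; rewrite -ltNye (lt_le_trans _ (leb_ge0 _)).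
rewrite -forallNE => Aoo.
suff add2e (e : {posnum R}) :
    leb (\bigcup_n A n) <= \sum_(i <oo) leb (A i) + e%:num%:E.
  by apply/lee_addgt0Pr => _/posnumP[].
rewrite (le_trans _ (epsilon_trick _ _ _))//.
pose P k (B : (option (Rn R n * Rn R n))^nat) := box_cover (A k) B /\
  \sum_(j <oo) box_volume (B j) <= leb (A k) + (e%:num / (2 ^ k.+1)%:R)%:E.
have [G PG] : {G : nat -> (option (Rn R n * Rn R n))^nat & forall k, P k (G k)}.
  apply: (@choice _ _ P) => k; rewrite /P /leb.
  set S := (X in ereal_inf X); move infS : (ereal_inf S) => iS.
  case: iS infS => [r Sr|Soo|Soo].
  - have en1 : (0 < e%:num / (2 ^ k.+1)%:R)%R by [].
    have /(lb_ereal_inf_adherent en1) : ereal_inf S \is a fin_num by rewrite Sr.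
    move=> [x [B AnB muBx] xS].
    by exists B; split => //; rewrite muBx -Sr; exact/ltW.
  - by have := Aoo k; rewrite /leb Soo.
  - suff : lbound S 0 by move/le_ereal_inf_tmp; rewrite Soo.
    by move=> /= _ [B AnB <-]; exact: nneseries_ge0.
pose mu := @box_volume; pose GG := uncurry G.
apply: (@le_trans _ _ (\esum_(i in setT) (mu \o GG) i)).
  rewrite /leb; apply: ereal_inf_lbound => /=.
  have /card_esym/ppcard_eqP[f] := card_nat2.
  exists (GG \o f).
    apply: (@subset_trans _  (\bigcup_k \bigcup_j box (G k j))) => [t [i _]|].
      by move=> /(PG i).1 [j _ ?]; exists i => //; exists j.
    move=> t [i _ [j _ Bijt]]; exists (f^-1%FUN (i, j)) => //=.
    by rewrite invK ?inE.
  rewrite -(esum_pred_image (mu \o GG) _ xpredT) ?[fun=> _]set_true//.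
    by rewrite image_eq.
  by move=> ? _; exact: box_volume_ge0.
rewrite (_ : esum _ _ = \sum_(i <oo) \sum_(j <oo) mu (G i j)); last first.
  pose J : nat -> set (nat * nat) := fun i => [set (i, j) | j in setT].
  rewrite (_ : setT = \bigcup_k J k); last first.
    by rewrite predeqE => -[a b]; split => // _; exists a => //; exists b.
  rewrite esum_bigcupT /=; last 2 first.
    - apply/trivIsetP => i j _ _ ij.
      rewrite predeqE => -[k m] /=; split => //= -[] [_] _ [<-{k} _].
      by move=> [m' _] [] /esym/eqP; rewrite (negbTE ij).
    - by move=> /= [k m]; exact: box_volume_ge0.
  rewrite -(image_id [set: nat]) -fun_true esum_pred_image//; last first.
    by move=> k _; apply: esum_ge0 => ? _; exact: box_volume_ge0.
  apply: eq_eseriesr => /= j _.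
  rewrite -(esum_pred_image (mu \o GG) (pair j) predT)//=.
  - by congr esum; rewrite predeqE => -[a b]; split; move=> [i _ <-]; exists i.
  - by move=> ? ? _ _; exact: (@can_inj _ _ _ snd).
apply: lee_lim.
- apply: is_cvg_nneseries => k *.
  by apply: nneseries_ge0 => m *; exact: box_volume_ge0.
- by apply: is_cvg_nneseries => k *; apply: adde_ge0.
- by near=> k; apply: lee_sum => i _; exact: (PG i).2.
Unshelve. all: by end_near. Qed.

HB.instance Definition _ := isOuterMeasure.Build R (Rn R n) leb
  leb0 leb_ge0 le_leb leb_sigma_subadditive.

End lebesgue_outer_measure.

HB.instance Definition _ (R : realType) (n : nat) :=
  Measurable.copy (Rn R n) (caratheodory_type (@leb R n)).

HB.instance Definition _ (R : realType) (n : nat) :=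
  isMeasure.Build _ (Rn R n) R (@leb R n)
    (@caratheodory_measure0 R (Rn R n) (@leb R n))
    (@caratheodory_measure_ge0 R (Rn R n) (@leb R n))
    (@caratheodory_measure_sigma_additive R (Rn R n) (@leb R n)).

Section leb_sigma_finite.
Local Open Scope ring_scope.
Context {R : realType} {n : nat}.

Lemma measurable_halfspace (i : 'I_n) (t : R) :
  measurable [set x : Rn R n | (x 0 i < t)%R].
Proof.
set H := [set x | _].
pose cutr (m : R -> R -> R) (w : Rn R n) : Rn R n :=
  (\row_j (if j == i then m (w 0 j) t else w 0 j))%R.
pose L (b : option (Rn R n * Rn R n)) :=
  if b is Some (u, v) then Some (u, cutr Num.min v) else None.
pose U (b : option (Rn R n * Rn R n)) :=
  if b is Some (u, v) then Some (cutr Num.max u, v) else None.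
have boxL b : box b `&` H `<=` box (L b).
  case: b => [[u v]|]/= x [] //= xuv xt j.
  rewrite mxE; case: eqP => [->|_]; last exact: xuv.
  by rewrite lt_min xt; have /andP[-> ->] := xuv i.
have boxU b : box b `&` ~` H `<=` box (U b).
  case: b => [[u v]|]/= x [] //= xuv /negP; rewrite -leNgt => xt j.
  rewrite mxE; case: eqP => [->|_]; last exact: xuv.
  by rewrite ge_max xt; have /andP[-> ->] := xuv i.
have volLU b : (@box_volume R n (L b) + box_volume (U b) = box_volume b)%E.
  case: b => [[u v]|]/=; last by rewrite adde0.
  rewrite -EFinD; congr EFin.
  have E (F : 'I_n -> R) :
      (\prod_j F j = F i * \prod_(j | j != i) F j)%R by rewrite (bigD1 i).
  rewrite !E !mxE eqxx.
  rewrite (eq_bigr (fun j => Num.max 0 (v 0 j - u 0 j))); last first.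
    by move=> j /negbTE ji; rewrite mxE ji.
  rewrite [X in (_ + _ * X)%R](eq_bigr (fun j => Num.max 0 (v 0 j - u 0 j))); last first.
    by move=> j /negbTE ji; rewrite mxE ji.
  rewrite -mulrDl; congr (_ * _)%R.
  rewrite /Num.max /Num.min.
  case: (ltP (v 0 i) t) => vt; case: (ltP (u 0 i) t) => ut; do ?case: ltP => ?; lra.
have vol_ge0 := @box_volume_ge0 R n.
apply: le_caratheodory_measurable => X.
apply: le_ereal_inf_tmp => _ [B XB <-].
rewrite -(eq_eseriesr (fun k _ => volLU (B k))) nneseriesD//.
apply: leeD; apply: ereal_inf_lbound.
- exists (L \o B) => // x [/XB[k _ Bx] Hx]; exists k => //.
  by apply: boxL; split.
- exists (U \o B) => // x [/XB[k _ Bx] Hx]; exists k => //.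
  by apply: boxU; split.
Qed.

Lemma measurable_box b : measurable (box b : set (Rn R n)).
Proof.
case: b => [[u v]|]; last exact: measurable0.
have -> : box (Some (u, v)) = \bigcap_(i in [set: 'I_n])
    (~` [set x : Rn R n | x 0 i < u 0 i] `&` [set x : Rn R n | x 0 i < v 0 i]).
  apply/seteqP; split=> [x xuv i _|x xuv i] /=.
    by have /andP[ux ->] := xuv i; split => //; apply/negP; rewrite -leNgt.
  by have [/= /negP] := xuv i I; rewrite -leNgt => -> ->.
apply: fin_bigcap_measurable; first exact: finite_finset.
move=> i _; apply: measurableI; last exact: measurable_halfspace.
exact/measurableC/measurable_halfspace.
Qed.

Let sigma_finite_leb : sigma_finite [set: Rn R n] leb.
Proof.
pose B (k : nat) : option (Rn R n * Rn R n) :=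
  Some (const_mx (- k%:R)%R, const_mx k%:R).
exists (box \o B).
  apply/esym/seteqP; split => // x _.
  exists (Num.truncn (\sum_i `|x 0 i|)%R).+1 => //= i; rewrite !mxE.
  set k := (_.+1%:R)%R; have xk : (`|x 0 i| < k)%R.
    apply: le_lt_trans (truncnS_gt _).
    by rewrite (bigD1 i)//= lerDl sumr_ge0.
  by move: xk; rewrite ltr_norml => /andP[/ltW -> ->].
move=> k; split; first exact: measurable_box.
apply: (@le_lt_trans _ _ (box_volume (B k))); last by rewrite ltry.
apply: ereal_inf_lbound.
exists (fun j => if j is 0%N then B k else None).
  by move=> x Bx; exists 0%N.
rewrite nneseries_recl//; last by move=> j _; exact: box_volume_ge0.
by rewrite eseries0 ?adde0// => -[].
Qed.

HB.instance Definition _ := 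
  Measure_isSigmaFinite.Build _ _ _ (@leb R n) sigma_finite_leb.

End leb_sigma_finite.

(* Closed cubes with sides parallel to the axes. *)
Record cube (R : realType) (n : nat) :=
  Cube { center : Rn R n; side : R; side_gt0 : (0 < side)%R }.

HB.instance Definition _ (R : realType) (n : nat) := gen_eqMixin (cube R n).
HB.instance Definition _ (R : realType) (n : nat) := gen_choiceMixin (cube R n).

Section function_spaces.
Context {R : realType} {n : nat}.
Implicit Types (Q : cube R n) (E : set (Rn R n)) (f g : Rn R n -> R[i]).

Definition dilate (a : R) Q : set (Rn R n) :=
  [set x | forall i, (`|x 0 i - center Q 0 i| <= a * side Q / 2)%R].

Definition cube_set Q : set (Rn R n) := dilate 1 Q.

(* The function f \chi_E. *)
Definition cutoff E f : Rn R n -> R[i] := fun x => if x \in E then f x else 0%R.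

Definition cmeasurable f :=
  measurable_fun setT (fun x => complex.Re (f x)) /\
  measurable_fun setT (fun x => complex.Im (f x)).

Definition cintegral f : R[i] :=
  ((\int[leb]_x complex.Re (f x)) +i* (\int[leb]_x complex.Im (f x)))%C%R.

Definition modulus f : Rn R n -> \bar R := fun x => (Normc.normc (f x))%:E.

Definition in_Lp (p : R) f := cmeasurable f /\ 'N[leb]_(p%:E) [modulus f] < +oo.

Definition supp f : set (Rn R n) := closure [set x | f x != 0%R].

Definition average (p : R) Q f : \bar R :=
  ((leb (cube_set Q))^-1 * \int[leb]_(x in cube_set Q) modulus f x `^ p) `^ p^-1.

(* [leb] is applied to level sets of functions which are not assumed to be
   measurable, where it is the outer measure. *)
Definition weak_norm (r : R) (g : Rn R n -> \bar R) : \bar R :=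
  ereal_sup [set t%:E * leb [set x | t%:E < `|g x|] `^ r^-1 | t in [set t | (0 < t)%R]].

(* || U ||_{L^r -> L^{r,\infty}}, equal to +oo when U is not bounded. *)
Definition weak_op_norm (r : R) (U : (Rn R n -> R[i]) -> Rn R n -> \bar R) : \bar R :=
  ereal_inf [set M%:E | M in [set M | (0 <= M)%R /\ forall f, in_Lp r f ->
    weak_norm r (U f) <= M%:E * 'N[leb]_(r%:E) [modulus f]]].

Definition weak_type (r : R) (U : (Rn R n -> R[i]) -> Rn R n -> \bar R) :=
  weak_op_norm r U < +oo.

End function_spaces.

Section operators.
Context {R : realType} {n : nat}.

(* T maps functions to functions; weak type (1,1) makes L^1 the domain on which
   T is known to be defined, and nothing is assumed of the values of T at
   functions outside L^1. Linearity is an identity between measurable functions,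
   hence holds almost everywhere. *)
Definition linear_op (T : (Rn R n -> R[i]) -> Rn R n -> R[i]) :=
  forall (a b : R[i]) f g, in_Lp 1 f -> in_Lp 1 g ->
    {ae leb, forall x, T (fun y => a * f y + b * g y)%R x = (a * T f x + b * T g x)%R}.

(* For rho = +oo the exponent 1 / rho' is 1, for rho = 1 it is 0. *)
Definition hormander (rho : \bar R) (K : Rn R n -> Rn R n -> R[i]) :=
  ereal_sup [set v | exists Q x' x'',
    [/\ dilate 2^-1%R Q x', dilate 2^-1%R Q x'' &
      v = \sum_(1 <= k <oo)
        leb (dilate (2 ^+ k)%R Q) `^ fine (hoelder_conjugate rho)^-1 *
        'N[leb]_rho [modulus (cutoff (dilate (2 ^+ k)%R Q `\` dilate (2 ^+ k.-1)%R Q)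
                                  (fun y => K x' y - K x'' y)%R)]]] < +oo.

(* The integral is required to converge absolutely, for bounded f with compact
   support. *)
Definition has_kernel (T : (Rn R n -> R[i]) -> Rn R n -> R[i])
    (K : Rn R n -> Rn R n -> R[i]) :=
  forall f, cmeasurable f -> (exists M, forall x, (Normc.normc (f x) <= M)%R) ->
    compact (supp f) ->
    {ae leb, forall x, ~ supp f x ->
      in_Lp 1 (fun y => K x y * f y)%R /\ T f x = cintegral (fun y => K x y * f y)%R}.

Definition singular_integral (T : (Rn R n -> R[i]) -> Rn R n -> R[i]) :=
  [/\ linear_op T,
      forall f, in_Lp 1 f -> cmeasurable (T f),
      weak_type 1 (fun f => modulus (T f)) &
      exists (rho : \bar R) (K : Rn R n -> Rn R n -> R[i]),
        [/\ 1 <= rho, forall x, cmeasurable (K x), hormander rho K & has_kernel T K]].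

(* e^{2 \pi i phi} f *)
Definition modulate (phi : Rn R n -> R) (f : Rn R n -> R[i]) : Rn R n -> R[i] :=
  fun x => ((cos (2 * pi * phi x) +i* sin (2 * pi * phi x))%C * f x)%R.

Definition max_modulated (T : (Rn R n -> R[i]) -> Rn R n -> R[i]) (A : Type)
    (phi : A -> Rn R n -> R) (f : Rn R n -> R[i]) : Rn R n -> \bar R :=
  fun x => ereal_sup [set modulus (T (modulate (phi a) f)) x | a in [set: A]].

Definition sublinear (U : (Rn R n -> R[i]) -> Rn R n -> \bar R) :=
  (forall f g, in_Lp 1 f -> in_Lp 1 g ->
    {ae leb, forall x, `|U (fun y => f y + g y)%R x| <= `|U f x| + `|U g x|}) /\
  (forall (a : R[i]) f, in_Lp 1 f ->
    {ae leb, forall x, `|U (fun y => a * f y)%R x| = (Normc.normc a)%:E * `|U f x|}).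

Definition W_property (q : R) (U : (Rn R n -> R[i]) -> Rn R n -> \bar R)
    (psi : R -> R) :=
  (forall s t, 0 < s -> s <= t -> t < 1 -> psi t <= psi s)%R /\
  forall (Q : cube R n) f (lambda : R), in_Lp q (cutoff (cube_set Q) f) ->
    (0 < lambda < 1)%R ->
    leb [set x | cube_set Q x /\
      (psi lambda)%:E * average q Q f < `|U (cutoff (cube_set Q) f) x|] <=
    lambda%:E * leb (cube_set Q).

(* ess sup_{x', x'' \in Q} |g(x') - g(x'')|; |oo - oo| = oo. *)
Definition ess_osc (Q : cube R n) (g : Rn R n -> \bar R) : \bar R :=
  ess_sup (@leb R n \x @leb R n)
    (fun p => `|g p.1 - g p.2| * (\1_(cube_set Q `*` cube_set Q) p)%:E).

Definition sharp_maximal (U : (Rn R n -> R[i]) -> Rn R n -> \bar R) (alpha : R)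
    (f : Rn R n -> R[i]) : Rn R n -> \bar R :=
  fun x => ereal_sup [set ess_osc Q (U (cutoff (~` dilate alpha Q) f)) |
                       Q in [set Q | cube_set Q x]].

Definition sparse (eta : R) (S : set (cube R n)) :=
  exists E : cube R n -> set (Rn R n),
    trivIset S E /\
    forall Q, S Q -> [/\ measurable (E Q), E Q `<=` cube_set Q &
                         eta%:E * leb (cube_set Q) <= leb (E Q)].

End operators.

(* Main.v *)
(** Iterating a local estimate.  Let [O] be a set of small measure containing
   (1) the points of a cube [Q] where [T^F (f chi_{alpha Q})] is large,
   (2) those where the sharp maximal function of [f chi_{alpha Q}] is large, and
   (3) the dyadic subcubes [P] on whose dilate [alpha P] the average of [|f|^s]
   is large.  Each part is controlled by, respectively, the [W_q] property, the
   weak type [(r,r)] bound and a Vitali covering.  Stop at the maximal dyadic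
   subcubes [P] of [Q] with [|P /\ O| > 2^-(n+1) |P|]: they have total measure at
   most [|Q| / 2], and at most half of each lies in [O].  Outside of them
   [T^F (f chi_{alpha Q})] is at most a multiple of the average of [f].  On [P],
   it differs from [T^F (f chi_{alpha P})] by [T^F (f chi_{alpha Q - alpha P})],
   whose oscillation on [P] is bounded by the sharp function at a point of [P]
   outside [O], and whose value at some point of [P] is bounded because there
   the previous two functions are both small.  Iterating over [Q], then over
   the stopping cubes, gives the sparse family of all dilated stopping cubes
   started from cubes [R] which partition the space and satisfy
   [supp f <= 3 R].

   The level sets need not be measurable, as [A] may be uncountable: instead of
   Lebesgue's density theorem, the proof uses a union of boxes containing a
   neighborhood of each point of the exceptional set. *)
Require Import Defs.
From HB Require Import structures.
From mathcomp Require Import all_boot all_order all_algebra.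
From mathcomp Require Import complex.
From mathcomp Require Import all_classical all_reals all_analysis.
From mathcomp Require Import measurable_realfun ess_sup_inf lra ring.
Set Implicit Arguments.
Unset Strict Implicit.
Unset Printing Implicit Defensive.
Import Order.TTheory GRing.Theory Num.Theory.
Import numFieldNormedType.Exports.
Local Open Scope classical_set_scope.
Local Open Scope ring_scope.
Local Open Scope ereal_scope.
Local Notation center := Defs.center.

(** By convexity, [(1 + e) ^+ n] lies below its chord between [e = 0] and [e = 1]. The bound is
    linear in [e], which makes the choice of a small [e] explicit later. *)
Lemma expr1D_le (R : realDomainType) (e : R) n : (0 <= e -> e <= 1 ->
  (1 + e) ^+ n <= 1 + e * (2 ^+ n - 1))%R.
Proof.
move=> e0 e1; elim: n => [|n IH]; first by rewrite !expr0 subrr mulr0 addr0.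
rewrite !exprS; set t := (2 ^+ n)%R in IH *.
have t1 : (1 <= t)%R by rewrite exprn_ege1// ler1n.
apply: le_trans (ler_wpM2l _ IH) _; first by rewrite addr_ge0.
have : (0 <= e * (t - 1) * (1 - e))%R by rewrite !mulr_ge0 ?subr_ge0.
lra.
Qed.

(** * Lebesgue measure of cubes *)

Section lebesgue_cubes.
Local Open Scope ring_scope.
Context {R : realType} {n : nat}.
Implicit Types (Q : cube R n) (X Y : set (Rn R n)).

Lemma cubeP Q Q' : center Q = center Q' -> side Q = side Q' -> Q = Q'.
Proof.
case: Q Q' => [c l l0] [c' l' l0'] /= cc ll; subst.
by rewrite (bool_irrelevance l0 l0').
Qed.

(* Half-open cubes, for exact partitions; [cube_set Q] has the same measure. *)
Definition hcube Q : set (Rn R n) :=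
  [set x | forall i, center Q 0 i - side Q / 2 <= x 0 i < center Q 0 i + side Q / 2].

Lemma hcubeE Q : hcube Q = box (Some
  (\row_i (center Q 0 i - side Q / 2), \row_i (center Q 0 i + side Q / 2)) ).
Proof. by apply/seteqP; split => x /= H i; have := H i; rewrite !mxE. Qed.

Lemma measurable_hcube Q : measurable (hcube Q).
Proof. by rewrite hcubeE; exact: measurable_box. Qed.

Lemma le_leb X Y : X `<=` Y -> (leb X <= leb Y)%E.
Proof. exact: (le_outer_measure (@leb R n)). Qed.

Lemma leb_bigcup_le (F : (set (Rn R n))^nat) :
  (leb (\bigcup_k F k) <= \sum_(k <oo) leb (F k))%E.
Proof. exact: (outer_measure_sigma_subadditive (@leb R n)). Qed.

Lemma lebU_le X Y : (leb (X `|` Y) <= leb X + leb Y)%E.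
Proof. exact: (outer_measureU2 (@leb R n)). Qed.

Lemma leb_ge0 X : (0 <= leb X)%E.
Proof. exact: (outer_measure_ge0 (@leb R n)). Qed.

(** A set of zero outer measure is Caratheodory measurable, so null sets can be recognised through
    [leb] alone, even among level sets not known to be measurable. *)
Lemma leb0_negligible X : (leb X <= 0)%E -> leb.-negligible X.
Proof.
move=> X0; exists X; split=> //; last by apply/eqP; rewrite eq_le leb_ge0 andbT.
apply: le_caratheodory_measurable => Y.
rewrite -[leRHS]add0e; apply: leeD; last by apply: le_leb; exact: subIsetl.
exact: le_trans (le_leb (@subIsetr _ _ _)) X0.
Qed.

Lemma negligible_leb0 X : leb.-negligible X -> leb X = 0%E.
Proof.
move=> [N [_ N0 XN]]; apply/eqP; rewrite eq_le leb_ge0 andbT -N0.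
exact: le_leb.
Qed.

Lemma leb_box_le (b : option (Rn R n * Rn R n)) : (leb (box b) <= box_volume b)%E.
Proof.
apply: ereal_inf_lbound; exists (fun j => if j is 0%N then b else None).
  by move=> x Bx; exists 0%N.
rewrite nneseries_recl//; last by move=> j _; exact: box_volume_ge0.
by rewrite eseries0 ?adde0// => -[].
Qed.

(** The affine images of the boxes covering [X] cover [Y], and their volumes are multiplied by
    [a ^+ n]. Applied in both directions between two cubes, this gives exact scaling. *)
Lemma leb_affine_le X Y (a : R) (b : Rn R n) : 0 < a ->
  (forall y, Y y -> exists2 x, X x & forall i, y 0 i = a * x 0 i + b 0 i) ->
  (leb Y <= (a ^+ n)%:E * leb X)%E.
Proof.
move=> a0 YX; have an0 : 0 < a ^+ n by rewrite exprn_gt0.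
rewrite -lee_pdivrMl//; apply: le_ereal_inf_tmp => _ [B XB <-].
rewrite lee_pdivrMl//.
pose g (w : Rn R n) : Rn R n := \row_i (a * w 0 i + b 0 i).
pose B' k := if B k is Some (u, v) then Some (g u, g v) else None.
apply: (@le_trans _ _ (\sum_(k <oo) box_volume (B' k))%E).
  apply: ereal_inf_lbound; exists B' => // y /YX[x /XB[k _ Bx] yx].
  exists k => //; rewrite /B'; case: (B k) Bx => [[u v]|]//= Bx i.
  by rewrite !mxE yx lerD2r ltrD2r ler_pM2l// ltr_pM2l.
rewrite -nneseriesZl//; last by move=> k _; exact: box_volume_ge0.
apply: lee_nneseries => [k _ _|k _]; first exact: box_volume_ge0.
rewrite /B'; case: (B k) => [[u v]|]/=; last by rewrite mule0.
rewrite -EFinM lee_fin (_ : a ^+ n = \prod_(i < n) a); last first.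
  by rewrite prodr_const card_ord.
rewrite -big_split/=.
apply: ler_prod => i _; rewrite le_max lexx/= !mxE.
have -> : a * v 0 i + b 0 i - (a * u 0 i + b 0 i) = a * (v 0 i - u 0 i) by ring.
by rewrite -[X in Num.max X _](mulr0 a) -maxr_pMr// ltW.
Qed.

Lemma leb_hcube_le Q Q' :
  (leb (hcube Q) <= ((side Q / side Q') ^+ n)%:E * leb (hcube Q'))%E.
Proof.
have q0 := side_gt0 Q; have q'0 := side_gt0 Q'; have qq := divr_gt0 q0 q'0.
apply: (@leb_affine_le _ _ _
  (\row_i (center Q 0 i - side Q / side Q' * center Q' 0 i))) => // y Qy.
exists (\row_i (center Q' 0 i + side Q' / side Q * (y 0 i - center Q 0 i)))%R.
  move=> i; rewrite mxE; have /andP[l r] := Qy i.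
  rewrite lerD2l ltrD2l -ler_pdivrMl ?divr_gt0// -ltr_pdivlMl ?divr_gt0//.
  rewrite (_ : (side Q' / side Q)^-1 * - (side Q' / 2) = - (side Q / 2)); last first.
    by field; rewrite !gt_eqF.
  rewrite (_ : (side Q' / side Q)^-1 * (side Q' / 2) = (side Q / 2)); last first.
    by field; rewrite !gt_eqF.
  by apply/andP; split; lra.
by move=> i; rewrite !mxE; field; rewrite !gt_eqF.
Qed.

Let unit_cube : cube R n := Cube (0 : Rn R n) (@ltr01 R).

(** Kept as an abstract factor: the estimates compare cubes with one another and are homogeneous in
    it. *)
Definition unit_volume : R := fine (leb (hcube unit_cube)).

Definition vol Q : R := side Q ^+ n * unit_volume.

Lemma leb_hcube Q : leb (hcube Q) = (vol Q)%:E.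
Proof.
have fin1 : leb (hcube unit_cube) \is a fin_num.
  rewrite ge0_fin_numE ?leb_ge0//; rewrite hcubeE.
  by apply: le_lt_trans (leb_box_le _) _; rewrite ltry.
have q0 := side_gt0 Q; have qn0 : 0 < side Q ^+ n by rewrite exprn_gt0.
rewrite /vol EFinM fineK//; apply/eqP; rewrite eq_le; apply/andP; split.
  by have := leb_hcube_le Q unit_cube; rewrite /= divr1.
have := leb_hcube_le unit_cube Q.
by rewrite /= div1r exprVn -lee_pdivrMl ?invr_gt0// invrK.
Qed.

(** The closed cube lies in the concentric half-open cube enlarged by [1 + e], for every [e > 0];
    let [e] tend to 0. *)
Lemma leb_hcube_cube_set Q : leb (cube_set Q) = leb (hcube Q).
Proof.
have q0 := side_gt0 Q.
have sub (e : R) (e0 : 0 < e) :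
    (leb (cube_set Q) <= ((1 + e) ^+ n * vol Q)%:E)%E.
  have e10 : 0 < (1 + e) * side Q by rewrite mulr_gt0// addr_gt0.
  have -> : (1 + e) ^+ n * vol Q = vol (Cube (center Q) e10).
    by rewrite /vol/= exprMn mulrA.
  rewrite -leb_hcube; apply: le_leb => x Qx i/=.
  have := Qx i; rewrite mul1r ler_norml => /andP[a b].
  have : 0 < e * side Q by rewrite mulr_gt0.
  by move=> eQ; apply/andP; split; lra.
apply/eqP; rewrite eq_le; apply/andP; split; last first.
  apply: le_leb => x Qx i; rewrite mul1r ler_norml.
  by have /andP[a b] := Qx i; apply/andP; split; lra.
rewrite leb_hcube; apply/lee_addgt0Pr => d d0.
have vol0 : 0 <= vol Q by rewrite -lee_fin -leb_hcube leb_ge0.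
(* The added 1 keeps the denominator of [e] positive, since [vol Q] is only known to be nonnegative
   here. *)
have D0 : 0 < 2 ^+ n * (vol Q + 1) by rewrite mulr_gt0 ?exprn_gt0// ltr_wpDl.
pose e := Num.min 1 (d / (2 ^+ n * (vol Q + 1))).
have e0 : 0 < e by rewrite lt_min ltr01 divr_gt0.
have e1 : e <= 1 by rewrite ge_min lexx.
have ed : e * (2 ^+ n * (vol Q + 1)) <= d.
  by rewrite -ler_pdivlMr// ge_min lexx orbT.
apply: le_trans (sub _ e0) _; rewrite -EFinD lee_fin.
apply: le_trans (ler_wpM2r vol0 (expr1D_le n (ltW e0) e1)) _.
rewrite mulrDl mul1r lerD2l; apply: le_trans ed.
rewrite -mulrA; apply: ler_wpM2l; first exact: ltW.
have := exprn_gt0 n (@ltr0n R 2); nra.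
Qed.

Lemma hcube_sub_cube_set Q : hcube Q `<=` cube_set Q.
Proof.
move=> x Qx i; rewrite mul1r ler_norml.
by have /andP[a b] := Qx i; apply/andP; split; lra.
Qed.

Definition cdil (a : R) (a0 : 0 < a) Q : cube R n :=
  Cube (center Q) (mulr_gt0 a0 (side_gt0 Q)).

Lemma cube_set_cdil a (a0 : 0 < a) Q : cube_set (cdil a0 Q) = dilate a Q.
Proof. by rewrite /cube_set /dilate/= mul1r. Qed.

Lemma vol_cdil a (a0 : 0 < a) Q : vol (cdil a0 Q) = a ^+ n * vol Q.
Proof. by rewrite /vol/= exprMn mulrA. Qed.

Lemma cdil_inj a (a0 : 0 < a) : injective (cdil a0).
Proof.
move=> Q Q' []; case: Q Q' => [c l l0] [c' l' l0'] /= -> /(mulfI (lt0r_neq0 a0)) ll.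
exact: cubeP.
Qed.

Lemma leb_cube_set Q : leb (cube_set Q) = (vol Q)%:E.
Proof. by rewrite leb_hcube_cube_set leb_hcube. Qed.

Lemma leb_dilate a (a0 : 0 < a) Q : leb (dilate a Q) = (a ^+ n * vol Q)%:E.
Proof. by rewrite -(cube_set_cdil a0) leb_cube_set vol_cdil. Qed.

Lemma measurable_coord (i : 'I_n) : measurable_fun setT (fun x : Rn R n => x 0 i).
Proof.
move=> _; apply: (measurability _ (RGenOInfty.measurableE R)) => //.
move=> _ [_ [t ->] <-]; rewrite setTI.
have -> : (fun x : Rn R n => x 0 i) @^-1` `]t, +oo[ =
    ~` \bigcap_k [set x | x 0 i < t + k.+1%:R^-1].
  apply/seteqP; split=> x /=; rewrite in_itv/= andbT => tx.
    move=> /(_ (Num.truncn (x 0 i - t)^-1) I)/=; apply/negP; rewrite -leNgt.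
    rewrite -lerBrDl -[leRHS]invrK lef_pV2 ?posrE ?invr_gt0 ?subr_gt0//.
    by apply/ltW/truncnS_gt.
  rewrite ltNge; apply/negP => xt; apply: tx => k _ /=.
  by apply: le_lt_trans xt _; rewrite ltrDl invr_gt0.
apply: measurableC; apply: bigcapT_measurable => k; exact: measurable_halfspace.
Qed.

Lemma measurable_dilate a Q : measurable (dilate a Q).
Proof.
have -> : dilate a Q = \bigcap_(i in [set: 'I_n])
    ((fun x : Rn R n => x 0 i) @^-1`
      `[center Q 0 i - a * side Q / 2, center Q 0 i + a * side Q / 2]).
  apply/seteqP; split=> [x xQ i _|x xQ i] /=.
    by rewrite in_itv/=; have := xQ i; rewrite distrC ler_distlC.
  by have := xQ i I; rewrite /= in_itv/= distrC ler_distlC.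
apply: fin_bigcap_measurable; first exact: finite_finset.
by move=> i _; rewrite -[_ @^-1` _]setTI; exact: measurable_coord.
Qed.

Lemma measurable_cube_set Q : measurable (cube_set Q).
Proof. exact: measurable_dilate. Qed.

Hypothesis n_gt0 : (0 < n)%N.

(* Dilating each box of an almost optimal cover by the factor [2 `^ n^-1] doubles
   its volume and makes the original box interior to the new one. *)
Lemma leb_neighborhood X (d : R) : 0 < d -> (leb X < +oo)%E ->
  exists O : set (Rn R n), [/\ measurable O, (leb O <= 2%:E * (leb X + d%:E))%E &
    forall x, X x -> exists2 e : R, 0 < e &
      forall y : Rn R n, (forall i, `|y 0 i - x 0 i| < e) -> O y].
Proof.
move=> d0 Xoo.
pose c : R := 2 `^ n%:R^-1.
have cn : c ^+ n = 2.
  by rewrite -powR_mulrn ?powR_ge0// -powRrM mulVf ?powRr1// pnatr_eq0 -lt0n.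
have c1 : 1 < c.
  rewrite ltNge; apply/negP => c1.
  have : c ^+ n <= 1 by rewrite exprn_ile1// powR_ge0.
  by rewrite cn; apply/negP; rewrite -ltNge ltr1n.
have c0 : 0 < c by apply: lt_trans c1.
have /(lb_ereal_inf_adherent d0) : leb X \is a fin_num by rewrite ge0_fin_numE ?leb_ge0.
move=> [_ [B XB <-] BX].
pose m (s : R) (u v : Rn R n) : Rn R n :=
  \row_i ((u 0 i + v 0 i) / 2 + s * (v 0 i - u 0 i) / 2).
pose B' k := if B k is Some (u, v) then Some (m (- c) u v, m c u v) else None.
exists (\bigcup_k box (B' k)); split.
- by apply: bigcupT_measurable => k; exact: measurable_box.
- apply: le_trans (leb_bigcup_le _) _.
  apply: (@le_trans _ _ (2%:E * \sum_(k <oo) box_volume (B k))%E); last first.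
    by rewrite lee_pmul2l//; exact: ltW.
  rewrite -nneseriesZl//; last by move=> k _; exact: box_volume_ge0.
  apply: lee_nneseries => [k _ _|k _]; first exact: leb_ge0.
  apply: le_trans (leb_box_le _) _.
  rewrite /B'; case: (B k) => [[u v]|]/=; last by rewrite mule0.
  rewrite -EFinM lee_fin -cn.
  rewrite (_ : c ^+ n = \prod_(i < n) c); last by rewrite prodr_const card_ord.
  rewrite -big_split/=; apply: ler_prod => i _; rewrite le_max lexx/= !mxE.
  rewrite (_ : _ - _ = c * (v 0 i - u 0 i)); last by field.
  by rewrite -[X in Num.max X _](mulr0 c) -maxr_pMr// ltW.
- move=> x /XB[k _]; case E: (B k) => [[u v]|]//= uxv.
  pose w := \big[Num.min/1]_(i < n) ((c - 1) * (v 0 i - u 0 i) / 2).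
  have uv i : u 0 i < v 0 i by have /andP[a b] := uxv i; apply: le_lt_trans a b.
  exists w.
    apply/bigmin_gtP; split => // i _.
    by rewrite !mulr_gt0// ?subr_gt0.
  move=> y yx; exists k => //; rewrite /B' E/= => i; rewrite !mxE.
  have wi : w <= (c - 1) * (v 0 i - u 0 i) / 2 by apply: bigmin_le_cond.
  have := lt_le_trans (yx i) wi; rewrite ltr_norml => /andP[a b].
  have /andP[ux xv] := uxv i.
  by apply/andP; split; lra.
Qed.

(** The space is a countable union of cubes centred at 0; if the unit cube were null, all of them
    would be null by scaling. *)
Lemma vol_gt0 Q : (0 < leb [set: Rn R n])%E -> 0 < vol Q.
Proof.
move=> T0; rewrite /vol mulr_gt0 ?exprn_gt0 ?side_gt0//.
rewrite lt0r fine_ge0 ?leb_ge0// andbT; apply/negP => /eqP u0.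
suff : (leb [set: Rn R n] <= 0)%E by rewrite leNgt T0.
pose q k : cube R n := Cube (0 : Rn R n) (ltr0Sn R k).
apply: (@le_trans _ _ (leb (\bigcup_k hcube (q k)))).
  apply: le_leb => x _.
  exists (Num.truncn (2 * \sum_i `|x 0 i|)).+1 => //= i; rewrite !mxE/=.
  set k := (_.+2%:R); have xk : (2 * `|x 0 i| < k).
    apply: (@lt_trans _ _ (Num.truncn (2 * \sum_i `|x 0 i|)).+1%:R); last first.
      by rewrite ltr_nat.
    apply: le_lt_trans (truncnS_gt _).
    by rewrite ler_pM2l// (bigD1 i)//= lerDl sumr_ge0.
  have := ler_norm (x 0 i); have := ler_norm (- x 0 i); rewrite normrN => a b.
  by apply/andP; split; lra.
apply: le_trans (leb_bigcup_le _) _.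
by rewrite eseries0// => k _ _; rewrite leb_hcube /vol/= u0 mulr0.
Qed.

End lebesgue_cubes.

(** * Countable families of sets *)

Section countable_families.
Local Open Scope ring_scope.
Context {R : realType} {n : nat} {T : Type}.

(** Subadditivity suffices on the side of [A], whose members may be non-measurable; only the
    disjoint measurable [B] requires additivity. *)
Lemma leb_bigcup_cmp (S : set T) (A B : T -> set (Rn R n)) (c : R) :
  countable S -> 0 <= c -> (forall P, S P -> measurable (B P)) -> trivIset S B ->
  (forall P, S P -> (leb (A P) <= c%:E * leb (B P))%E) ->
  (leb (\bigcup_(P in S) A P) <= c%:E * leb (\bigcup_(P in S) B P))%E.
Proof.
move=> /countable_injP[g ginj] c0 mB tB AB.
(* Reindexing over the naturals through the injection [g]: [F E i] is the set [E P] with [g P = i],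
   or empty if there is no such [P]. *)
pose F (E : T -> set (Rn R n)) i := \bigcup_(P in [set P | S P /\ g P = i]) E P.
have FE E : \bigcup_(P in S) E P = \bigcup_i F E i.
  apply/seteqP; split=> [x [P SP Px]|x [i _ [P [SP _] Px]]]; last by exists P.
  by exists (g P) => //; exists P.
have F1 E i : (F E i = set0) + {P | S P /\ g P = i & F E i = E P}.
  have [H|H] := pselect (exists P, S P /\ g P = i); last first.
    by left; apply/seteqP; split=> // x [P iP _]; apply: H; exists P.
  right; have [P [SP gP]] := cid H; exists P => //.
  apply/seteqP; split=> [x [P' [SP' gP']]|x Px]; last by exists P.
  by rewrite (ginj P' P) ?inE// gP' gP.
rewrite !FE (_ : leb (\bigcup_i F B i) = (\sum_(i <oo) leb (F B i))%E); last first.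
  apply: measure_semi_bigcup.
  - by move=> i; have [->//|[P [SP _] ->]] := F1 B i; exact: mB.
  - move=> i j _ _ [x [[P [SP gP] Px] [P' [SP' gP'] P'x]]].
    by rewrite -gP -gP'; congr g; apply: tB => //; exists x.
  - apply: bigcupT_measurable => i.
    by have [->//|[P [SP _] ->]] := F1 B i; exact: mB.
rewrite -nneseriesZl//; apply: le_trans (leb_bigcup_le _) _.
apply: lee_nneseries => [i _ _|i _]; first exact: leb_ge0.
have [->|[P [SP gP] ->]] := F1 A i; first by rewrite measure0 mule_ge0// leb_ge0.
have [FB|[P' [SP' gP'] ->]] := F1 B i.
  rewrite FB measure0 mule0; apply: le_trans (AB _ SP) _.
  suff -> : B P = set0 by rewrite measure0 mule0.
  by apply/seteqP; split=> // x Bx; rewrite -FB; exists P.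
by rewrite (ginj P' P) ?inE// ?gP' ?gP//; exact: AB.
Qed.

Lemma negligible_countable (S : set T) (A : T -> set (Rn R n)) :
  countable S -> (forall P, S P -> leb.-negligible (A P)) ->
  leb.-negligible (\bigcup_(P in S) A P).
Proof.
move=> /countable_injP[g ginj] A0.
pose F i := \bigcup_(P in [set P | S P /\ g P = i]) A P.
apply: (@negligibleS _ _ _ _ (\bigcup_i F i)).
  by move=> x [P SP Px]; exists (g P) => //; exists P.
apply: negligible_bigcup => i.
have [H|H] := pselect (exists P, S P /\ g P = i); last first.
  apply: negligibleS (negligible_set0 _) => x [P iP _]; apply: H; exists P.
  exact: iP.
have [P [SP gP]] := H; apply: negligibleS (A0 _ SP) => x [P' [SP' gP']].
by rewrite (ginj P' P) ?inE// gP' gP.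
Qed.

Lemma countable_bigcup_measurable (S : set T) (A : T -> set (Rn R n)) :
  countable S -> (forall P, S P -> measurable (A P)) ->
  measurable (\bigcup_(P in S) A P).
Proof.
move=> /countable_injP[g ginj] mA.
have -> : \bigcup_(P in S) A P =
    \bigcup_i \bigcup_(P in [set P | S P /\ g P = i]) A P.
  apply/seteqP; split=> [x [P SP Px]|x [i _ [P [SP _] Px]]]; last by exists P.
  by exists (g P) => //; exists P.
apply: bigcupT_measurable => i.
have [[P [SP gP]]|H] := pselect (exists P, S P /\ g P = i); last first.
  rewrite (_ : \bigcup_(P in _) _ = set0)//.
  by apply/seteqP; split=> // x [P iP _]; apply: H; exists P.
rewrite (_ : \bigcup_(P in _) _ = A P); first exact: mA.
apply/seteqP; split=> [x [P' [SP' gP']]|x Px]; last by exists P.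
by rewrite (ginj P' P) ?inE// gP' gP.
Qed.

End countable_families.

(** * Dyadic cells and stopping times *)

Section dyadic_cells.
Local Open Scope ring_scope.
Context {R : realType} {n : nat}.
Implicit Types (Q P : cube R n) (x y : Rn R n) (e : {ffun 'I_n -> bool}).

Lemma half_side_gt0 Q : 0 < side Q / 2.
Proof. by rewrite divr_gt0 ?side_gt0. Qed.

Definition child Q e : cube R n :=
  Cube (\row_i (center Q 0 i + (if e i then 1 else -1) * (side Q / 4)) : Rn R n)
       (half_side_gt0 Q).

Definition quadrant Q x : {ffun 'I_n -> bool} := [ffun i => center Q 0 i <= x 0 i].

Fixpoint dyadic Q k x : cube R n :=
  if k is k'.+1 then child (dyadic Q k' x) (quadrant (dyadic Q k' x) x) else Q.

(** The dyadic descendants are enumerated by finite words of sign vectors; countability and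
    transitivity follow from this encoding. *)
Definition cells Q : set (cube R n) := range (foldl child Q).

Lemma hcube_quadrant Q x : hcube Q x -> hcube (child Q (quadrant Q x)) x.
Proof.
move=> Qx i /=; have /andP[a b] := Qx i; rewrite !mxE ffunE.
by case: (leP (center Q 0 i) (x 0 i)) => cx; apply/andP; split; lra.
Qed.

Lemma hcube_child Q e : hcube (child Q e) `<=` hcube Q.
Proof.
move=> x + i => /(_ i)/=; rewrite !mxE; have := side_gt0 Q.
by case: (e i) => q0 /andP[a b]; apply/andP; split; lra.
Qed.

Lemma quadrant_child Q e x : hcube (child Q e) x -> quadrant Q x = e.
Proof.
move=> Px; apply/ffunP => i; rewrite ffunE; have := Px i; rewrite /= !mxE.
have := side_gt0 Q; case: (e i) => q0 /andP[a b]; first by lra.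
by apply/negbTE; rewrite -ltNge; lra.
Qed.

Lemma hcube_dyadic Q k x : hcube Q x -> hcube (dyadic Q k x) x.
Proof. by move=> Qx; elim: k => //= k; exact: hcube_quadrant. Qed.

(** Any point of a child determines its sign vector, so two points of one cell have followed the
    same path from [Q]. This is the nestedness of dyadic cells. *)
Lemma dyadic_eq Q j k x y : hcube (dyadic Q k x) y -> (j <= k)%N ->
  dyadic Q j y = dyadic Q j x.
Proof.
elim: k j => [|k IH] j; first by rewrite leqn0 => _ /eqP ->.
move=> /= Py; have yk := hcube_child Py.
rewrite leq_eqVlt => /orP[/eqP ->|]; last by rewrite ltnS; exact: IH.
by rewrite /= (IH k)//; congr child; exact: quadrant_child Py.
Qed.

Lemma side_dyadic Q k x : side (dyadic Q k x) = side Q / 2 ^+ k.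
Proof. by elim: k => [|k /= ->]; rewrite ?divr1// exprS invfM; lra. Qed.

Lemma vol_child Q e : vol (child Q e) = vol Q / 2 ^+ n.
Proof. by rewrite /vol/= expr_div_n mulrAC. Qed.

(** In each coordinate the center moves by [side Q / 4], while the half side of the dilate shrinks
    by [a * side Q / 4], which is no less. *)
Lemma dilate_child a Q e : 1 <= a -> dilate a (child Q e) `<=` dilate a Q.
Proof.
move=> a1 x + i => /(_ i)/=; rewrite !mxE => xP.
apply: le_trans (_ : _ <= a * (side Q / 2) / 2 + side Q / 4) _.
  rewrite -[X in `|X|](subrKA (center Q 0 i + (if e i then 1 else -1) * (side Q / 4))).
  apply: le_trans (ler_normD _ _) _; apply: lerD => //.
  rewrite addrC addKr normrM; have := side_gt0 Q => q0.
  by case: (e i); rewrite ?normrN normr1 mul1r ger0_norm; lra.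
have : 0 <= (a - 1) * side Q by rewrite mulr_ge0 ?subr_ge0// ltW// side_gt0.
lra.
Qed.

Lemma cells_refl Q : cells Q Q. Proof. by exists [::]. Qed.

Lemma cells_trans Q P P' : cells Q P -> cells P P' -> cells Q P'.
Proof. by move=> [w _ <-] [w' _ <-]; exists (w ++ w') => //; rewrite foldl_cat. Qed.

Lemma cells_child Q e : cells Q (child Q e). Proof. by exists [:: e]. Qed.

Lemma cells_dyadic Q k x : cells Q (dyadic Q k x).
Proof.
elim: k => [|k IH]; first exact: cells_refl.
by apply: cells_trans IH _; exact: cells_child.
Qed.

Lemma countable_cells Q : countable (cells Q).
Proof. exact/(sub_countable (card_image_le _ _))/countableP. Qed.

Lemma hcube_cells Q P : cells Q P -> hcube P `<=` hcube Q.
Proof.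
move=> [w _ <-]; elim: w Q => [|e w IH] Q //=.
by apply: subset_trans (IH _) (@hcube_child _ _).
Qed.

Lemma cells_dyadic_eq Q P x : cells Q P -> hcube P x -> exists k, P = dyadic Q k x.
Proof.
move=> [w _ <-]; elim/last_ind: w => [|w e IH]; first by exists 0%N.
rewrite foldl_rcons => Px; have [k kE] := IH (hcube_child Px).
by exists k.+1; rewrite /= -kE (quadrant_child Px).
Qed.

Lemma dilate_cells a Q P : 1 <= a -> cells Q P -> dilate a P `<=` dilate a Q.
Proof.
move=> a1 [w _ <-]; elim: w Q => [|e w IH] Q //=.
by apply: subset_trans (IH _) _; exact: dilate_child.
Qed.

Lemma dyadic_small Q x d : hcube Q x -> 0 < d ->
  exists k, forall y, hcube (dyadic Q k x) y -> forall i, `|y 0 i - x 0 i| < d.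
Proof.
move=> Qx d0; exists (Num.truncn (side Q / d)).+1; set k := _.+1 => y ky i.
have xk := hcube_dyadic k Qx.
have sk : side (dyadic Q k x) < d.
  rewrite side_dyadic ltr_pdivrMr ?exprn_gt0// mulrC -ltr_pdivrMr//.
  apply: lt_trans (truncnS_gt _) _.
  by rewrite -natrX ltr_nat ltn_expl.
have /andP[a b] := ky i; have /andP[a' b'] := xk i.
by rewrite ltr_norml; apply/andP; split; lra.
Qed.

(* [P] is selected when it is the first dyadic cell around a point more than a
   fraction [2^-(n+1)] of which lies in [O]. Its parent is not, hence the bound
   [vol P / 2]. *)
Lemma stopping_cells Q (E O : set (Rn R n)) : (forall P, 0 < vol P) ->
  measurable O -> (leb O <= (vol Q / 2 ^+ n.+2)%:E)%E ->
  (forall x, E x -> hcube Q x -> exists k, hcube (dyadic Q k x) `<=` O) ->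
  exists S : set (cube R n), [/\
    forall P, S P -> [/\ cells Q P, side P < side Q & (leb (hcube P `&` O) <= (vol P / 2)%:E)%E],
    trivIset S hcube,
    (leb (\bigcup_(P in S) hcube P) <= (vol Q / 2)%:E)%E &
    forall x, hcube Q x -> E x -> exists2 P, S P & hcube P x].
Proof.
move=> vol_pos mO leO EO.
pose bad P := ((vol P / 2 ^+ n.+1)%:E < leb (hcube P `&` O))%E.
have Qgood : ~ bad Q.
  apply/negP; rewrite -leNgt; apply: le_trans (le_leb (@subIsetr _ _ _)) _.
  apply: le_trans leO _; rewrite lee_fin; apply: ler_wpM2l; first exact/ltW.
  by rewrite lef_pV2 ?posrE ?exprn_gt0// ler_eXn2l// ltr1n.
pose S := [set P | exists x k, [/\ P = dyadic Q k x, hcube Q x, bad P &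
  forall j, (j < k)%N -> ~ bad (dyadic Q j x)]].
have tS : trivIset S hcube.
  move=> P P' [x [k [-> _ bk gk]]] [x' [k' [-> _ bk' gk']]] [y [yk yk']].
  wlog kk' : x k x' k' bk gk bk' gk' yk yk' / (k <= k')%N.
    by move=> W; have [kk'|/ltnW kk'] := leqP k k'; [apply: W|apply/esym; apply: W].
  move: kk'; rewrite leq_eqVlt => /orP[/eqP kk'|kk'].
    by subst; rewrite -(dyadic_eq yk)// -(dyadic_eq yk').
  case: (gk' _ kk'); rewrite -(dyadic_eq yk' (ltnW kk')) (dyadic_eq yk)//.
exists S; split => //.
(* Generation 0 is excluded because [Q] is not bad; hence a selected cell has a parent inside
   [Q]. *)
- move=> P [x [[|k] [-> Qx bk gk]]] //; split.
  + exact: cells_dyadic.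
  + rewrite side_dyadic ltr_pdivrMr ?exprn_gt0// ltr_pMr ?side_gt0//.
    by rewrite exprn_egt1// ltr1n.
  + have := gk k (ltnSn k) => /negP; rewrite -leNgt => H.
    apply: le_trans (le_trans _ H) _.
      by apply: le_leb; apply: setSI; exact: hcube_child.
    by rewrite lee_fin /= vol_child exprS invfM mulrA mulrAC.
(* Each selected [P] has volume at most [2 ^+ n.+1] times the measure of its part in [O], and these
   parts are disjoint; the total is at most [2 ^+ n.+1 * (vol Q / 2 ^+ n.+2)]. *)
- apply: (@le_trans _ _ ((2 ^+ n.+1)%:E * leb (\bigcup_(P in S) (hcube P `&` O)))%E).
    apply: leb_bigcup_cmp.
    + apply: sub_countable (countable_cells Q); apply: subset_card_le.
      by move=> P [x [k [-> _ _ _]]]; exact: cells_dyadic.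
    + exact: exprn_ge0.
    + by move=> P _; apply: measurableI => //; exact: measurable_hcube.
    + by move=> P P' SP SP' [x [[Px _] [P'x _]]]; apply: tS => //; exists x.
    + move=> P [x [k [_ _ /ltW bk _]]].
      by rewrite leb_hcube -lee_pdivrMl ?exprn_gt0// -EFinM mulrC.
  rewrite -lee_pdivlMl ?exprn_gt0//.
  apply: le_trans (le_leb _) (le_trans leO _); first by move=> x [P _ []].
  by rewrite -EFinM lee_fin [_ ^+ n.+2]exprS invfM; lra.
- move=> x Qx Ex; have [k kO] := EO _ Ex Qx.
  have exbad : exists k, `[< bad (dyadic Q k x) >].
    exists k; apply/asboolP; rewrite /bad setIidl// leb_hcube lte_fin.
    rewrite ltr_pdivrMr ?exprn_gt0// ltr_pMr//.
    by rewrite exprn_egt1// ltr1n.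
  case: (ex_minnP exbad) => j /asboolP bj jmin.
  exists (dyadic Q j x); last exact: hcube_dyadic.
  exists x, j; split => // i ij bi.
  by have := jmin i; rewrite leqNgt ij => /(_ (asboolT bi)).
Qed.

End dyadic_cells.

(** * A partition by cubes whose triples contain a given cube *)

Section root_cubes.
Local Open Scope ring_scope.
Context {R : realType} {n : nat}.
Implicit Types (Q P : cube R n) (x y : Rn R n).

Lemma double_side_gt0 Q : 0 < 2 * side Q.
Proof. by rewrite mulr_gt0 ?side_gt0. Qed.

(** [Q] is the upper corner of its parent in all directions if [b] holds, the lower corner
    otherwise. *)
Definition parent Q (b : bool) : cube R n :=
  Cube (\row_i (center Q 0 i - (if b then 1 else -1) * (side Q / 2)) : Rn R n)
       (double_side_gt0 Q).

Lemma child_parent Q b : child (parent Q b) [ffun=> b] = Q.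
Proof.
apply: cubeP => /=; last by rewrite mulrC mulKf.
by apply/rowP => i; rewrite !mxE ffunE; case: b; field.
Qed.

(* The alternation makes the ancestors exhaust the space. *)
Fixpoint ancestor Q k : cube R n :=
  if k is k'.+1 then parent (ancestor Q k') (odd k') else Q.

Lemma ancestor_sub Q j k : (j <= k)%N -> hcube (ancestor Q j) `<=` hcube (ancestor Q k).
Proof.
move=> /subnK <-; elim: (k - j)%N => //= m IH; apply: subset_trans IH _ => x.
rewrite -{1}(child_parent (ancestor Q (m + j)) (odd (m + j))).
exact: hcube_child.
Qed.

Lemma side_ancestor Q k : side Q <= side (ancestor Q k).
Proof.
elim: k => //= k; move: (side_gt0 Q) (side_gt0 (ancestor Q k)); lra.
Qed.

(** Two consecutive steps extend the ancestor once upwards and once downwards, each time by at least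
    [side Q]. *)
Lemma ancestor_large Q m x : (forall i, `|x 0 i - center Q 0 i| < m%:R * side Q) ->
  hcube (ancestor Q m.*2) x.
Proof.
move=> xm; suff H i :
    center (ancestor Q m.*2) 0 i - side (ancestor Q m.*2) / 2 <=
      center Q 0 i - side Q / 2 - m%:R * side Q /\
    center Q 0 i + side Q / 2 + m%:R * side Q <=
      center (ancestor Q m.*2) 0 i + side (ancestor Q m.*2) / 2.
  move=> i; have [a b] := H i; have := xm i; rewrite ltr_norml => /andP[c d].
  by have q0 := side_gt0 Q; apply/andP; split; lra.
elim: m {xm} => [|m [a b]]; first by rewrite mul0r subr0 addr0.
rewrite doubleS /= !mxE/= odd_double/=.
have s := side_ancestor Q m.*2; rewrite -[m.+1%:R]natr1.
have q0 := side_gt0 Q; split; lra.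
Qed.

(* The partition consists of [Q] and of the siblings of all its ancestors. *)
Lemma root_partition Q : exists S : set (cube R n), [/\ countable S,
  trivIset S hcube, (forall x, exists2 P, S P & hcube P x) &
  forall P, S P -> hcube Q `<=` dilate 3 P].
Proof.
pose J := ancestor Q.
have JE k : J k = child (J k.+1) [ffun=> odd k] by rewrite /= child_parent.
pose sib k (e : {ffun 'I_n -> bool}) := child (J k.+1) e.
pose S := [set P | P = Q \/ exists k e, e != [ffun=> odd k] /\ P = sib k e].
have sib_notin k j e x : (j <= k)%N -> e != [ffun=> odd k] ->
    hcube (J j) x -> hcube (sib k e) x -> False.
  move=> jk ek /(ancestor_sub jk); rewrite -/(J k) JE => /quadrant_child xq.
  by move=> /quadrant_child xe; move: ek; rewrite -xe xq eqxx.
exists S; split.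
- apply: (@sub_countable _ _ _ (range (fun o : option (nat * {ffun 'I_n -> bool}) =>
    if o is Some (k, e) then sib k e else Q))); last first.
    exact/(sub_countable (card_image_le _ _))/countableP.
  apply: subset_card_le => P [->|[k [e [_ ->]]]]; first by exists None.
  by exists (Some (k, e)).
- move=> P P' [->|[k [e [ek ->]]]] [->|[k' [e' [ek' ->]]]] [x [Px P'x]] //.
  + by case: (sib_notin k' 0%N e' x).
  + by case: (sib_notin k 0%N e x).
  + have [kk'|k'k|kk'] := ltngtP k k'; last first.
    * by subst; rewrite /sib -(quadrant_child Px) -(quadrant_child P'x).
    * by case: (sib_notin k k'.+1 e x) => //; exact: hcube_child P'x.
    * by case: (sib_notin k' k.+1 e' x) => //; exact: hcube_child Px.
- move=> x.
  have exJ : exists k, `[< hcube (J k) x >].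
    pose m := (Num.truncn ((\sum_i `|x 0 i - center Q 0 i|) / side Q)).+1.
    exists m.*2; apply/asboolP; apply: ancestor_large => i.
    rewrite -ltr_pdivrMr ?side_gt0//; apply: le_lt_trans (truncnS_gt _).
    by rewrite ler_pM2r ?invr_gt0 ?side_gt0// (bigD1 i)//= lerDl sumr_ge0.
  case: (ex_minnP exJ) => -[|k] /asboolP Jx kmin; first by exists Q => //; left.
  exists (sib k (quadrant (J k.+1) x)); last exact: hcube_quadrant.
  right; exists k, (quadrant (J k.+1) x); split => //; apply/eqP => qk.
  have : hcube (J k) x by rewrite JE -qk; exact: hcube_quadrant.
  by move/asboolT/kmin; rewrite ltnn.
- move=> P [->|[k [e [_ ->]]]] x xQ i.
    have /andP[a b] := xQ i; have q0 := side_gt0 Q.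
    by rewrite ler_norml; apply/andP; split; lra.
  (* The triple of any child of [J k.+1] contains [J k.+1], which in turn contains [Q]. *)
  have /andP[] := ancestor_sub (leq0n k.+1) xQ i.
  rewrite -/(J k.+1); have := side_gt0 (J k.+1); rewrite /sib /child.
  move: (J k.+1) => P' p0; rewrite /= !mxE ler_norml => a b.
  by apply/andP; case: (e i); split; lra.
Qed.

End root_cubes.

(** * Iteration of a local bound *)

Section iteration.
Local Open Scope ring_scope.
Context {R : realType} {n : nat}.
Variable ch : cube R n -> set (cube R n).
Hypothesis ch_cells : forall Q P, ch Q P -> cells Q P /\ side P < side Q.
Hypothesis ch_triv : forall Q, trivIset (ch Q) hcube.
Hypothesis ch_half : forall Q, (leb (\bigcup_(P in ch Q) hcube P) <= (vol Q / 2)%:E)%E.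
Implicit Types (Q P : cube R n) (x : Rn R n).

Inductive desc : cube R n -> cube R n -> Prop :=
| desc_refl Q : desc Q Q
| desc_step Q P P' : ch Q P -> desc P P' -> desc Q P'.

Lemma desc_cells Q P : desc Q P -> cells Q P.
Proof.
elim=> {Q P} [Q|Q P P' /ch_cells[QP _] _]; first exact: cells_refl.
exact: cells_trans.
Qed.

Lemma desc_side Q P : desc Q P -> side P <= side Q.
Proof.
by elim=> {Q P} [//|Q P P' /ch_cells[_ /ltW PQ] _ P'P]; exact: le_trans PQ.
Qed.

Lemma countable_ch Q : countable (ch Q).
Proof.
apply: sub_countable (countable_cells Q); apply: subset_card_le.
by move=> P /ch_cells[].
Qed.

(** These are the disjoint portions that witness sparseness: each is at least half of its cube. *)
Definition kept Q : set (Rn R n) := hcube Q `\` \bigcup_(P in ch Q) hcube P.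

Lemma measurable_kept Q : measurable (kept Q).
Proof.
apply: measurableD; first exact: measurable_hcube.
by apply: countable_bigcup_measurable => [|P _]; [exact: countable_ch|exact: measurable_hcube].
Qed.

Lemma leb_kept Q : ((vol Q / 2)%:E <= leb (kept Q))%E.
Proof.
have : ((vol Q)%:E <= leb (kept Q) + (vol Q / 2)%:E)%E.
  rewrite -leb_hcube; apply: le_trans (leeD2l _ (ch_half Q)).
  apply: le_trans (lebU_le _ _); apply: le_leb => x Qx.
  by have [?|?] := pselect ((\bigcup_(P in ch Q) hcube P) x); [right|left].
rewrite -leeBlDr// => H; apply: le_trans H.
by rewrite -EFinB lee_fin; lra.
Qed.

(** A lost point lies in stopping cubes of every generation. Each generation at least halves the
    measure, so [m] of them leave at most [2^-m] of the cube. *)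
Lemma lost_negligible Q : leb.-negligible (hcube Q `\` \bigcup_(P in desc Q) kept P).
Proof.
set Z := fun Q => hcube Q `\` \bigcup_(P in desc Q) kept P.
apply: leb0_negligible.
have H m P : (leb (Z P) <= (2^-1 ^+ m * vol P)%:E)%E.
  elim: m P => [|m IH] P.
    by rewrite expr0 mul1r -leb_hcube; apply: le_leb => x [].
  (* A point lost by [P] lies in one of the cubes of [ch P] and is lost by it as well. *)
  apply: (@le_trans _ _ (leb (\bigcup_(P' in ch P) Z P'))).
    apply: le_leb => x [Px nx].
    have [[P' PP' P'x]|nch] := pselect ((\bigcup_(P' in ch P) hcube P') x).
      exists P' => //; split=> // -[P'' P'P'' P''x]; apply: nx; exists P'' => //.
      exact: desc_step PP' P'P''.
    by exfalso; apply: nx; exists P => //; exact: desc_refl.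
  apply: le_trans (leb_bigcup_cmp (c := 2^-1 ^+ m) (B := hcube) _ _ _ _ _) _.
  - exact: countable_ch.
  - exact: exprn_ge0.
  - by move=> P' _; exact: measurable_hcube.
  - exact: ch_triv.
  - by move=> P' _; rewrite leb_hcube -EFinM.
  - rewrite exprSr -mulrA EFinM; apply: lee_wpmul2l.
      by rewrite lee_fin exprn_ge0.
    by rewrite mulrC.
apply/lee_addgt0Pr => d d0; rewrite add0e.
pose m := Num.truncn (vol Q / d).
apply: le_trans (H m.+1 Q) _; rewrite lee_fin exprVn ler_pdivrMl ?exprn_gt0//.
rewrite -ler_pdivrMr//; apply/ltW/(lt_trans (truncnS_gt _)).
by rewrite -natrX ltr_nat ltn_expl.
Qed.

Variable roots : set (cube R n).
Hypothesis roots_countable : countable roots.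
Hypothesis roots_triv : trivIset roots hcube.

Definition nodes : set (cube R n) := \bigcup_(Q in roots) desc Q.

Lemma countable_nodes : countable nodes.
Proof.
apply: bigcup_countable => // Q _.
apply: sub_countable (countable_cells Q); apply: subset_card_le.
exact: desc_cells.
Qed.

Lemma desc_total Q Q' x : nodes Q -> nodes Q' -> hcube Q x -> hcube Q' x ->
  desc Q Q' \/ desc Q' Q.
Proof.
move=> [W rW WQ] [W' rW' W'Q'] Qx Q'x.
have WW' : W = W'.
  apply: roots_triv => //; exists x; split.
    exact: hcube_cells (desc_cells WQ) _ Qx.
  exact: hcube_cells (desc_cells W'Q') _ Q'x.
move: W'Q'; rewrite -WW' => WQ' {rW rW' WW' W'}.
elim: WQ Q' Q'x WQ' Qx => {W Q} [Q|W P Q WP PQ IH] Q' Q'x WQ' Qx; first by left.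
case: WQ' Q'x WP => {W Q'} [W|W P' Q' WP' P'Q'] Q'x WP.
  by right; exact: desc_step WP PQ.
apply: IH => //; suff -> : P = P' by [].
apply: (ch_triv WP WP'); exists x; split.
  exact: hcube_cells (desc_cells PQ) _ Qx.
exact: hcube_cells (desc_cells P'Q') _ Q'x.
Qed.

Lemma desc_kept Q Q' x : desc Q Q' -> kept Q x -> kept Q' x -> Q = Q'.
Proof.
case=> // {}Q P {}Q' QP PQ' [_ nx] [Q'x _]; exfalso; apply: nx; exists P => //.
exact: hcube_cells (desc_cells PQ') _ Q'x.
Qed.

Lemma trivIset_kept : trivIset nodes kept.
Proof.
move=> Q Q' nQ nQ' [x [Qx Q'x]].
have [H|H] := desc_total nQ nQ' Qx.1 Q'x.1; first exact: desc_kept H Qx Q'x.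
exact/esym/(desc_kept H Q'x Qx).
Qed.

Variables (g : cube R n -> Rn R n -> \bar R) (b : cube R n -> \bar R) (C : R).
Hypothesis C_ge0 : 0 <= C.
Hypothesis b_ge0 : forall Q, (0 <= b Q)%E.

(** Abstract form of the local step: [g Q] will be the modulus of the operator applied to [f] cut
    off to the dilate of [Q], and [b Q] the average of [f] over that dilate. *)
Definition local_bound Q x := hcube Q x ->
  ((forall P, ch Q P -> ~ hcube P x) -> (g Q x <= C%:E * b Q)%E) /\
  (forall P, ch Q P -> hcube P x -> (g Q x <= C%:E * b Q + g P x)%E).

(** The local bounds telescope along the finite chain of stopping cubes from [Q] down to [Q'], where
    the point is kept and no remainder is left. Sides decrease strictly along the chain, so no cube
    is repeated. *)
Lemma desc_bound Q Q' x : (forall P, desc Q P -> local_bound P x) ->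
  desc Q Q' -> kept Q' x ->
  exists l : seq (cube R n), [/\ uniq l,
    (forall P, P \in l -> desc Q P /\ hcube P x) &
    (g Q x <= C%:E * \sum_(P <- l) b P)%E].
Proof.
move=> + QQ'; elim: QQ' => {Q Q'} [Q|Q P Q' QP PQ' IH] loc Q'x.
  exists [:: Q]; rewrite big_seq1; split => //.
    by move=> P; rewrite inE => /eqP ->; split; [exact: desc_refl|exact: Q'x.1].
  apply: (loc _ (desc_refl Q) Q'x.1).1 => P QP Px.
  by apply: Q'x.2; exists P.
have Px : hcube P x by apply: hcube_cells (desc_cells PQ') _ Q'x.1.
have [|l [ul lP gl]] := IH _ Q'x.
  by move=> P' PP'; apply: loc; exact: desc_step QP PP'.
exists (Q :: l); split.
- rewrite /= ul andbT; apply/negP => /lP[/desc_side PQ _].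
  by have [_] := ch_cells QP; rewrite ltNge PQ.
- move=> P'; rewrite inE => /orP[/eqP ->|/lP[PP' P'x]].
    split; first exact: desc_refl.
    by have [/hcube_cells H _] := ch_cells QP; exact: H.
  by split => //; exact: desc_step QP PP'.
- rewrite big_cons ge0_muleDr//; last exact: sume_ge0.
  have Qx : hcube Q x by have [/hcube_cells H _] := ch_cells QP; exact: H.
  apply: le_trans ((loc _ (desc_refl Q) Qx).2 _ QP Px) _.
  exact: leeD2l.
Qed.

Hypothesis loc : forall Q, leb.-negligible [set x | ~ local_bound Q x].

Lemma sparse_iteration : leb.-negligible [set x | exists Q,
  [/\ roots Q, hcube Q x &
      ~ (g Q x <= C%:E * \esum_(P in nodes) (b P * (\1_(hcube P) x)%:E))%E]].
Proof.
(* Almost every point satisfies the local bound at all of the countably many nodes and is kept by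
   some descendant of its root. *)
pose N1 := \bigcup_(Q in nodes) [set x | ~ local_bound Q x].
pose N2 := \bigcup_(Q in nodes) (hcube Q `\` \bigcup_(P in desc Q) kept P).
apply: (@negligibleS _ _ _ _ (N1 `|` N2)); last first.
  apply: negligibleU; apply: negligible_countable => //; try exact: countable_nodes.
  by move=> Q _; exact: lost_negligible.
move=> x [Q [rQ Qx ng]]; apply: contrapT => /not_orP[n1 n2]; apply: ng.
have nQ P : desc Q P -> nodes P by exists Q.
have [[Q' QQ' Q'x]|nk] := pselect ((\bigcup_(P in desc Q) kept P) x); last first.
  by exfalso; apply: n2; exists Q => //; exact/nQ/desc_refl.
have [|l [ul lP gl]] := desc_bound _ QQ' Q'x.
  by move=> P QP; apply: contrapT => nP; apply: n1; exists P => //; exact: nQ.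
apply: le_trans gl _; apply: lee_wpmul2l; first by rewrite lee_fin.
apply: esum_ge; exists [set` l].
  by split; [exact: finite_seq|move=> P /lP[/nQ]].
rewrite -fsbig_seq//= big_seq [leRHS]big_seq; apply: lee_sum => P /lP[_ Px].
by rewrite indicE mem_set// mule1.
Qed.

End iteration.

Lemma countable_enum (T : choiceType) (S : set T) : countable S ->
  exists e : nat -> option T, forall P, S P <-> exists i, e i = Some P.
Proof.
move=> /countable_injP[g ginj].
exists (fun i => if pselect (exists P, S P /\ g P = i) is left H
                 then Some (projT1 (cid H)) else None) => P; split=> [SP|].
  exists (g P); case: pselect => [H|nH]; last by exfalso; apply: nH; exists P.
  case: (cid H) => P' /= [SP' gP']; congr Some.
  by apply: ginj; rewrite ?inE.
move=> [i +]; case: pselect => // H [<-].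
by case: (cid H) => P' /= [].
Qed.

(** * Vitali covering and the dyadic maximal function *)

Section maximal_function.
Local Open Scope ring_scope.
Context {R : realType} {n : nat}.
Implicit Types (Q P : cube R n) (x y : Rn R n).

(** Continuity from below along increasing finite unions; it reduces the covering argument to finite
    families. *)
Lemma leb_bigcup_finite (T : choiceType) (S : set T) (A : T -> set (Rn R n)) (K : \bar R) :
  countable S -> (forall P : T, S P -> measurable (A P)) ->
  (forall s : seq T, (forall P : T, P \in s -> S P) ->
    (leb (\bigcup_(P in [set` s]) A P) <= K)%E) ->
  (leb (\bigcup_(P in S) A P) <= K)%E.
Proof.
move=> /countable_enum[e eS] mA AK.
pose F k := \bigcup_(P in [set` pmap e (iota 0 k)]) A P.
have sS k (P : T) : P \in pmap e (iota 0 k) -> S P.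
  by rewrite mem_pmap => /mapP[i _ /esym eP]; apply/eS; exists i.
have mF k : measurable (F k).
  apply: fin_bigcup_measurable; first exact: finite_seq.
  by move=> P /sS; exact: mA.
have -> : \bigcup_(P in S) A P = \bigcup_k F k.
  apply/seteqP; split=> x.
    move=> [P /eS[i ei] Px]; exists i.+1 => //; exists P => //.
    suff : P \in pmap e (iota 0 i.+1) by [].
    by rewrite mem_pmap; apply/mapP; exists i; rewrite ?mem_iota ?ltnS ?leqnn.
  by move=> [k _ [P /sS SP Px]]; exists P.
have ndF : nondecreasing_seq F.
  move=> k m km; apply/subsetPset => x [P /= Pk Px]; exists P => //=.
  move: Pk; rewrite !mem_pmap => /mapP[i + eP].
  rewrite mem_iota /= add0n => ik.
  by apply/mapP; exists i => //; rewrite mem_iota /= add0n (leq_trans ik).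
have cF := nondecreasing_cvg_mu (mu := @leb R n) mF (bigcupT_measurable _ mF) ndF.
rewrite -(cvg_lim _ cF)//; apply: lime_le; first by apply/cvg_ex; eexists; exact: cF.
by apply: nearW => k; apply: AK; exact: sS.
Qed.

Lemma max_side (s : seq (cube R n)) : s != [::] ->
  exists2 Q, Q \in s & forall P, P \in s -> side P <= side Q.
Proof.
elim: s => // Q s IH _; have [->|/IH[Q' Q's Q'max]] := eqVneq s [::].
  by exists Q; rewrite ?inE// => P; rewrite inE => /eqP ->.
have [QQ'|/ltW Q'Q] := leP (side Q) (side Q').
  exists Q'; first by rewrite inE Q's orbT.
  by move=> P; rewrite inE => /orP[/eqP ->//|]; exact: Q'max.
exists Q; first by rewrite inE eqxx.
by move=> P; rewrite inE => /orP[/eqP ->//|/Q'max H]; exact: le_trans Q'Q.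
Qed.

Lemma cube_set_meets Q P : side P <= side Q -> cube_set P `&` cube_set Q !=set0 ->
  cube_set P `<=` dilate 3 Q.
Proof.
move=> PQ [y [yP yQ]] x xP i; have := xP i; have := yP i; have := yQ i.
rewrite !mul1r !ler_norml => /andP[a b] /andP[c d] /andP[e f].
by apply/andP; split; lra.
Qed.

Variable h : Rn R n -> \bar R.
Hypothesis measurable_h : measurable_fun setT h.
Hypothesis h_ge0 : forall x, (0 <= h x)%E.
Local Notation F A := (\int[leb]_(x in A) h x)%E.

Let F_ge0 A : (0 <= F A)%E. Proof. exact: integral_ge0. Qed.

Let F_le A B : measurable A -> measurable B -> A `<=` B -> (F A <= F B)%E.
Proof. by move=> mA mB; apply: ge0_subset_integral => //; exact: measurable_funTS. Qed.

(* Finite Vitali covering: keep a largest cube, whose triple contains every cube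
   meeting it, and recurse on the cubes disjoint from it. *)
Lemma vitali_finite (c : R) (s : seq (cube R n)) : 0 <= c ->
  (forall P, P \in s -> ((vol P)%:E <= c%:E * F (cube_set P))%E) ->
  (leb (\bigcup_(P in [set` s]) cube_set P) <=
    (3 ^+ n * c)%:E * F (\bigcup_(P in [set` s]) cube_set P))%E.
Proof.
move=> c0; have [m] := ubnP (size s); elim: m s => // m IH s sm sF.
have [->|s0] := eqVneq s [::].
  by rewrite set_nil bigcup_set0 measure0 integral_set0 mule0.
have c30 : 0 <= 3 ^+ n * c by rewrite mulr_ge0 ?exprn_ge0.
have [Q Qs Qmax] := max_side s0.
pose s' := [seq P <- s | `[< cube_set P `&` cube_set Q = set0 >]].
have mU (t : seq (cube R n)) : measurable (\bigcup_(P in [set` t]) cube_set P).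
  apply: fin_bigcup_measurable; first exact: finite_seq.
  by move=> P _; exact: measurable_cube_set.
apply: (@le_trans _ _ (leb (dilate 3 Q `|` \bigcup_(P in [set` s']) cube_set P))).
  apply: le_leb => x [P /= Ps Px].
  have [PQ|PQ] := pselect (cube_set P `&` cube_set Q = set0).
    by right; exists P => //=; rewrite mem_filter Ps andbT; exact/asboolP.
  left; apply: cube_set_meets Px; first exact: Qmax.
  by apply/set0P/eqP.
apply: le_trans (lebU_le _ _) _.
apply: (@le_trans _ _ ((3 ^+ n * c)%:E *
    (F (cube_set Q) + F (\bigcup_(P in [set` s']) cube_set P)))%E).
  rewrite ge0_muleDr//; apply: leeD.
    rewrite leb_dilate// !EFinM -muleA; apply: lee_wpmul2l; last exact: sF.
    by rewrite lee_fin exprn_ge0.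
  apply: IH => [|P]; last by rewrite mem_filter => /andP[_]; exact: sF.
  rewrite -ltnS; apply: leq_trans sm; rewrite ltnS size_filter ltn_neqAle count_size andbT -all_count -has_predC.
  (* The list shortens because [Q] itself is discarded: it contains its center, hence meets
     itself. *)
  apply/hasP; exists Q => //=; apply/asboolP; rewrite setIid => Q0.
  suff : cube_set Q (center Q) by rewrite Q0.
  by move=> i; rewrite subrr normr0 mul1r divr_ge0// ltW// side_gt0.
apply: lee_wpmul2l; first by rewrite lee_fin.
rewrite -ge0_integral_setU//=.
- apply: F_le => //.
    by apply: measurableU => //; exact: measurable_cube_set.
  move=> x [Qx|[P /=]]; first by exists Q.
  by rewrite mem_filter => /andP[_ Ps] Px; exists P.
- exact: measurable_cube_set.
- exact: measurable_funTS.
- apply/disj_setPS => x [Qx [P /=]].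
  rewrite mem_filter => /andP[/asboolP PQ _] Px.
  by suff : set0 x by []; rewrite -PQ.
Qed.

(** Cross-multiplied form of: the average of [h] over the dilate of [P] exceeds [M] times that over
    the dilate of [Q]. The common factor [a ^+ n] cancels. *)
Definition heavy (a M : R) Q P :=
  ((M * vol P)%:E * F (dilate a Q) < (vol Q)%:E * F (dilate a P))%E.

(* The weak type (1,1) bound for a dyadic maximal function whose averages are
   taken over the dilates of the cells. *)
Lemma leb_heavy_cells (a M : R) Q : (forall P, 0 < vol P) -> 1 <= a -> 0 < M ->
  (F (dilate a Q) < +oo)%E ->
  (leb (\bigcup_(P in [set P | cells Q P /\ heavy a M Q P]) hcube P) <=
   ((3 * a) ^+ n / M * vol Q)%:E)%E.
Proof.
move=> vol_pos a1 M0 Foo.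
have a0 : 0 < a by exact: lt_le_trans a1.
have Ffin : F (dilate a Q) \is a fin_num by rewrite ge0_fin_numE.
have an0 : 0 < a ^+ n by rewrite exprn_gt0.
move FQ : (fine (F (dilate a Q))) => fQ.
have FE : F (dilate a Q) = fQ%:E by rewrite -FQ fineK.
have := F_ge0 (dilate a Q); rewrite FE lee_fin le_eqVlt => /orP[/eqP f0|f0].
  rewrite (_ : [set P | _] = set0) ?bigcup_set0.
    rewrite measure0 lee_fin ltW// mulr_gt0// divr_gt0// exprn_gt0//.
    by rewrite mulr_gt0.
  apply/seteqP; split=> // P [QP]; rewrite /heavy FE -f0 mule0 => H.
  suff : (F (dilate a P) <= 0)%E.
    move=> H'; have := lt_le_trans H (lee_wpmul2l _ H').
    by rewrite mule0 ltxx lee_fin => /(_ (ltW (vol_pos Q))).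
  have -> : 0%E = F (dilate a Q) by rewrite FE -f0.
  apply: F_le; try exact: measurable_dilate.
  exact: dilate_cells.
(* With this [c], heaviness of [P] bounds the volume of its dilate by [c] times the integral over
   it, as the covering lemma requires. *)
pose c := a ^+ n * vol Q / (M * fQ).
have c0 : 0 <= c by rewrite divr_ge0// ltW// mulr_gt0.
apply: (@le_trans _ _ (leb (\bigcup_(P in [set P | cells Q P /\ heavy a M Q P])
    cube_set (cdil a0 P)))).
  apply: le_leb => x [P QP Px]; exists P => //.
  rewrite cube_set_cdil => i; have /andP[l r] := Px i.
  have : side P <= a * side P by rewrite ler_pMl ?side_gt0.
  by move=> ?; rewrite ler_norml; apply/andP; split; lra.
apply: leb_bigcup_finite.
- apply: sub_countable (countable_cells Q); apply: subset_card_le.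
  by move=> P [].
- by move=> P _; exact: measurable_cube_set.
- move=> s sH.
  rewrite (_ : \bigcup_(P in [set` s]) cube_set (cdil a0 P) =
      \bigcup_(P in [set` map (cdil a0) s]) cube_set P); last first.
    apply/seteqP; split=> x [P /= Ps Px].
      by exists (cdil a0 P) => //=; exact: map_f.
    by move: Ps Px => /mapP[P' P's ->] Px; exists P'.
  apply: le_trans (vitali_finite (c := c) _ _) _ => //.
    move=> _ /mapP[P /sH[QP hP] ->]; rewrite vol_cdil cube_set_cdil.
    move: hP; rewrite /heavy FE -EFinM => /ltW hP.
    have d0 : 0 <= a ^+ n / (M * fQ) by rewrite divr_ge0// ltW// mulr_gt0.
    rewrite (_ : c = a ^+ n / (M * fQ) * vol Q); last by rewrite /c mulrAC.
    rewrite [(_ * vol Q)%:E]EFinM -muleA; apply: le_trans (lee_wpmul2l _ hP); last by rewrite lee_fin.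
    rewrite -EFinM lee_fin le_eqVlt; apply/orP; left; apply/eqP.
    by field; rewrite !gt_eqF.
  apply: (@le_trans _ _ ((3 ^+ n * c)%:E * fQ%:E)%E).
    apply: lee_wpmul2l; first by rewrite lee_fin mulr_ge0 ?exprn_ge0.
    rewrite -FE; apply: F_le; last first.
    + move=> x [_ /mapP[P /sH[QP _] ->]]; rewrite cube_set_cdil.
      exact: dilate_cells.
    + exact: measurable_dilate.
    + apply: fin_bigcup_measurable; first exact: finite_seq.
      by move=> P _; exact: measurable_cube_set.
  rewrite -EFinM lee_fin /c exprMn le_eqVlt; apply/orP; left; apply/eqP.
  by field; rewrite !gt_eqF.
Qed.

End maximal_function.

(** Young's inequality for [w ^ q] times 1, with exponents [s / q] and [s / (s - q)]. The two
    coefficients sum to 1, so integrating it for a normalised function compares averages. *)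
Lemma powR_le_mix (R : realType) (q s w : R) : (0 < q -> q <= s -> 0 <= w ->
  w `^ q <= q / s * w `^ s + (1 - q / s))%R.
Proof.
move=> q0; rewrite le_eqVlt => /orP[/eqP <- _|qs w0].
  by rewrite divff ?gt_eqF// mul1r subrr addr0.
have s0 := lt_trans q0 qs.
have sq0 : (0 < s - q)%R by rewrite subr_gt0.
have := @conjugate_powR R (w `^ q)%R 1%R (s / q)%R (s / (s - q))%R (powR_ge0 _ _) ler01
  (divr_gt0 s0 q0) (divr_gt0 s0 sq0).
rewrite mulr1 -powRrM mulrCA divff ?gt_eqF// mulr1 powR1 !invf_div => H.
apply: le_trans (H _) _; first by rewrite -mulrDl addrC subrK divff ?gt_eqF.
rewrite le_eqVlt; apply/orP; left; apply/eqP.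
by rewrite mulrC; congr (_ + _)%R; field; rewrite gt_eqF.
Qed.

(** * Averages *)

Section averages.
Local Open Scope ring_scope.
Context {R : realType} {n : nat}.
Implicit Types (Q P : cube R n) (f : Rn R n -> R[i]) (E : set (Rn R n)) (p q s : R).

Lemma measurable_modulus f : cmeasurable f -> measurable_fun setT (modulus f).
Proof.
move=> [mRe mIm]; apply/measurable_EFinP.
rewrite (_ : (fun x => _) = (fun x =>
    (complex.Re (f x) ^+ 2 + complex.Im (f x) ^+ 2) `^ 2^-1)); last first.
  apply/funext => x; rewrite powR12_sqrt ?addr_ge0 ?sqr_ge0//.
  by case: (f x) => a b.
apply: (measurableT_comp (measurable_powR _)).
by apply: measurable_funD; apply: measurable_funX.
Qed.

Lemma modulus_ge0 f x : (0 <= modulus f x)%E.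
Proof. by rewrite lee_fin; case: (f x) => a b; exact: sqrtr_ge0. Qed.

Lemma measurable_modulus_poweR f p : cmeasurable f ->
  measurable_fun setT (fun x => modulus f x `^ p)%E.
Proof.
by move=> mf; apply: (measurableT_comp (measurable_poweR p)); exact: measurable_modulus.
Qed.

Lemma cmeasurable_cutoff E f : measurable E -> cmeasurable f -> cmeasurable (cutoff E f).
Proof.
move=> mE [mRe mIm].
have mb : measurable_fun [set: Rn R n] (fun x => x \in E).
  apply: (measurable_fun_bool true); rewrite setTI.
  rewrite (_ : _ @^-1` _ = E)//.
  by apply/seteqP; split=> [x xE|x xE]; [exact: set_mem|exact: mem_set].
have m0 : measurable_fun [set: Rn R n] (fun=> 0 : R) by exact: measurable_cst.
split.
  rewrite (_ : (fun x => _) = (fun x => if x \in E then complex.Re (f x) else 0)).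
    exact: (measurable_fun_ifT mb mRe m0).
  by apply/funext => x; rewrite /cutoff; case: ifP.
rewrite (_ : (fun x => _) = (fun x => if x \in E then complex.Im (f x) else 0)).
  exact: (measurable_fun_ifT mb mIm m0).
by apply/funext => x; rewrite /cutoff; case: ifP.
Qed.

Lemma Lnorm_cutoff p E f : 0 < p -> measurable E ->
  ('N[leb]_(p%:E) [modulus (cutoff E f)] =
   (\int[leb]_(x in E) modulus f x `^ p) `^ p^-1)%E.
Proof.
move=> p0 mE; rewrite unlock; congr (_ `^ _)%E.
rewrite [RHS]integral_mkcond; apply: eq_integral => x _.
rewrite patchE gee0_abs ?modulus_ge0// /cutoff /modulus; case: ifP => // _.
by rewrite /= expr0n/= addr0 sqrtr0 powR0// gt_eqF.
Qed.

Lemma integral_modulus_le q s (c d : R) E f : 0 <= c -> 0 <= d ->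
  (forall w : R, 0 <= w -> w `^ q <= c * w `^ s + d) ->
  measurable E -> cmeasurable f ->
  (\int[leb]_(x in E) modulus f x `^ q <=
   c%:E * \int[leb]_(x in E) modulus f x `^ s + d%:E * leb E)%E.
Proof.
move=> c0 d0 H mE mf.
have mm p : measurable_fun E (fun x => modulus f x `^ p)%E.
  by apply: measurable_funTS; exact: measurable_modulus_poweR.
have pge0 p x : E x -> (0 <= modulus f x `^ p)%E by move=> _; exact: poweR_ge0.
have cge0 x : E x -> (0 <= c%:E * modulus f x `^ s)%E.
  by move=> Ex; apply: mule_ge0; [rewrite lee_fin|exact: pge0].
have md : measurable_fun E (fun=> d%:E) by exact: measurable_cst.
have dge0 x : E x -> (0 <= d%:E)%E by rewrite lee_fin.
have mc : measurable_fun E (fun x => c%:E * modulus f x `^ s)%E.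
  exact/measurable_funeM/mm.
rewrite -(ge0_integralZl _ mE (mm s) (pge0 s) (c0 : (0 <= c%:E)%E)).
rewrite -(integral_cst _ mE) -(ge0_integralD _ mE cge0 mc dge0 md).
apply: (ge0_le_integral _ mE (pge0 q) (mm q)); first exact: emeasurable_funD.
move=> x _; rewrite /modulus !poweR_EFin -EFinM -EFinD lee_fin.
by apply: H; have := modulus_ge0 f x; rewrite lee_fin.
Qed.

Lemma in_Lp_cutoff q s E f : 1 <= q -> q <= s -> measurable E -> (leb E < +oo)%E ->
  cmeasurable f -> (\int[leb]_(x in E) modulus f x `^ s < +oo)%E ->
  in_Lp q (cutoff E f).
Proof.
move=> q1 qs mE Eoo mf foo; have q0 : 0 < q by exact: lt_le_trans q1.
split; first exact: cmeasurable_cutoff.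
rewrite Lnorm_cutoff//; apply: poweR_lty.
have s0 := lt_le_trans q0 qs.
have qs0 : 0 <= q / s by rewrite divr_ge0// ltW.
have qs1 : 0 <= 1 - q / s by rewrite subr_ge0 ler_pdivrMr// mul1r.
apply: le_lt_trans (integral_modulus_le qs0 qs1 _ mE mf) _.
  by move=> w; exact: powR_le_mix.
by apply: lte_add_pinfty; apply: lte_mul_pinfty; rewrite ?lee_fin.
Qed.

Lemma averageE p Q f : 0 < vol Q -> average p Q f =
  (((vol Q)^-1%:E * \int[leb]_(x in cube_set Q) modulus f x `^ p) `^ p^-1)%E.
Proof.
by move=> Q0; rewrite /average leb_cube_set inver gt_eqF.
Qed.

Lemma average_ge0 p Q f : (0 <= average p Q f)%E.
Proof. exact: poweR_ge0. Qed.

Lemma average_mono q s Q f : 0 < vol Q -> 0 < q -> q <= s -> cmeasurable f ->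
  (average q Q f <= average s Q f)%E.
Proof.
move=> Q0 q0 qs mf; have s0 := lt_le_trans q0 qs; rewrite !averageE//.
pose X p := (\int[leb]_(x in cube_set Q) modulus f x `^ p)%E.
have X0 p : (0 <= X p)%E by apply: integral_ge0 => x _; exact: poweR_ge0.
have [Xoo|] := eqVneq (X s) +oo%E.
  rewrite -/(X s) Xoo gt0_muley ?lte_fin ?invr_gt0// poweRyr ?leey//.
  by rewrite invr_neq0// gt_eqF.
rewrite -ltey => Xoo; have /fineK XE : X s \is a fin_num by rewrite ge0_fin_numE.
have xs0 : 0 <= fine (X s) by rewrite fine_ge0.
rewrite -/(X s) -/(X q) -XE -EFinM poweR_EFin.
set a := (_ `^ s^-1)%R; have a0 : 0 <= a by exact: powR_ge0.
(* Normalise by [B], slightly above the [s]-average and therefore positive even if that average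
   vanishes; the mixed bound for [w / B] then integrates to at most [vol Q]. *)
apply/lee_addgt0Pr => d d0; rewrite -EFinD; set B := a + d.
have B0 : 0 < B by rewrite ltr_wpDl.
rewrite -[leRHS](_ : (B%:E `^ q) `^ q^-1 = _)%E; last first.
  by rewrite -poweRrM divff ?gt_eqF// poweRe1// lee_fin ltW.
apply: gt0_ler_poweR; rewrite ?in_itv/= ?leey ?andbT.
- by rewrite invr_ge0 ltW.
- by rewrite mule_ge0// lee_fin invr_ge0 ltW.
- by rewrite lee_fin powR_ge0.
rewrite lee_pdivrMl// -EFinM.
have xsB : fine (X s) <= vol Q * B `^ s.
  rewrite -ler_pdivrMl//; apply: le_trans (_ : a `^ s <= _).
    by rewrite -powRrM mulVf ?gt_eqF// powRr1// mulr_ge0 ?invr_ge0// ltW.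
  apply: ge0_ler_powR; rewrite ?nnegrE//; first exact: ltW.
    exact: ltW.
  by rewrite lerDl ltW.
have Bq0 : 0 < B `^ q by exact: powR_gt0.
have Bs0 : 0 < B `^ s by exact: powR_gt0.
have qs0 : 0 <= q / s by rewrite divr_ge0// ltW.
have qs1 : 0 <= 1 - q / s by rewrite subr_ge0 ler_pdivrMr// mul1r.
have c0 : 0 <= B `^ q * (q / s) / B `^ s by rewrite !mulr_ge0// ?invr_ge0 ltW.
have d10 : 0 <= B `^ q * (1 - q / s) by rewrite mulr_ge0// ltW.
apply: le_trans (integral_modulus_le (s := s) c0 d10 _ (@measurable_cube_set R n Q) mf) _.
  move=> w w0; have wE p : w `^ p = B `^ p * (w / B) `^ p.
    by rewrite -powRM ?divr_ge0//; [rewrite mulrC divfK ?gt_eqF|exact: ltW|exact: ltW].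
  rewrite (wE q) (wE s).
  apply: le_trans (ler_wpM2l (ltW Bq0) (powR_le_mix q0 qs (divr_ge0 w0 (ltW B0)))) _.
  rewrite le_eqVlt; apply/orP; left; apply/eqP.
  by field; rewrite !gt_eqF.
rewrite leb_cube_set -/(X s) -XE -!EFinM -EFinD lee_fin.
apply: le_trans (lerD (ler_wpM2l c0 xsB) (lexx _)) _.
rewrite le_eqVlt; apply/orP; left; apply/eqP.
by field; rewrite !gt_eqF.
Qed.

End averages.

(** * Operators *)

Section operators.
Local Open Scope ring_scope.
Context {R : realType} {n : nat}.
Implicit Types (Q P : cube R n) (f h : Rn R n -> R[i]) (g : Rn R n -> \bar R).
Implicit Types (U : (Rn R n -> R[i]) -> Rn R n -> \bar R).

(** Fubini: almost every section of a null set of the product is null. *)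
Lemma ess_osc_sections Q g (m : \bar R) : (ess_osc Q g <= m)%E ->
  {ae leb, forall x, cube_set Q x ->
    {ae leb, forall y, cube_set Q y -> (`|g x - g y| <= m)%E}}.
Proof.
move=> /ess_supP[N [mN N0 NS]].
have mphi := measurable_fun_xsection (@leb R n) mN.
have : (\int[leb]_x `|leb (xsection N x)| = 0)%E.
  by rewrite -[RHS]N0; apply: eq_integral => x _; rewrite gee0_abs// leb_ge0.
move=> /(ae_eq_integral_abs _ measurableT mphi)[Z [mZ Z0 ZS]].
exists Z; split => // x /= nx; apply: ZS => /= x0; apply: nx => Qx.
exists (xsection N x); split; [exact: measurable_xsection|exact: x0|].
move=> y /= ny; apply/mem_set/NS => /= H; apply: ny => Qy; move: H.
by rewrite indicE mem_set// mule1.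
Qed.

(** Positive outer measure forces [G] to contain a point of [Q] whose section is null; comparison
    with the value there bounds [g] almost everywhere on [Q]. [G] may be non-measurable. *)
Lemma ae_oscillation Q g (m A : R) (G : set (Rn R n)) :
  (ess_osc Q g <= m%:E)%E -> (0 < leb (G `&` cube_set Q))%E ->
  (forall x, G x -> (`|g x| <= A%:E)%E) ->
  {ae leb, forall y, cube_set Q y -> (`|g y| <= (A + m)%:E)%E}.
Proof.
move=> /ess_osc_sections/negligible_leb0 N0 G0 GA.
have [x [[Gx Qx] xG]] : exists x, (G `&` cube_set Q) x /\
    {ae leb, forall y, cube_set Q y -> (`|g x - g y| <= m%:E)%E}.
  apply: contrapT => H; move: G0; rewrite ltNge => /negP; apply.
  rewrite -[leRHS]N0; apply: le_leb => x GQx /= H'; apply: H; exists x.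
  by split => //; apply: H'; case: GQx.
apply: filterS xG => y xy Qy; move: (xy Qy) (GA _ Gx).
case: (g x) => [a||]//; case: (g y) => [b||]//=; rewrite !lee_fin => ab aA.
rewrite -[b](subKr a); apply: le_trans (ler_normB _ _) _.
exact: lerD.
Qed.

(** The infimum defining the norm is itself an admissible constant: divide by the norm of [h], or,
    if that is zero, use any admissible constant. *)
Lemma weak_op_bound r U h (t : R) : 0 < t ->
  weak_type r U -> in_Lp r h ->
  (t%:E * leb [set x | t%:E < `|U h x|] `^ r^-1 <=
    weak_op_norm r U * 'N[leb]_(r%:E) [modulus h])%E.
Proof.
move=> t0; rewrite /weak_type /weak_op_norm; set S := [set _ | _ in _] => Soo hr.
have /fineK nuE : ('N[leb]_(r%:E) [modulus h])%E \is a fin_num.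
  by rewrite ge0_fin_numE ?Lnorm_ge0//; case: hr.
set L := (t%:E * _)%E.
have H (M : R) : 0 <= M /\ (forall f, in_Lp r f ->
    weak_norm r (U f) <= M%:E * 'N[leb]_(r%:E) [modulus f])%E ->
    (L <= M%:E * 'N[leb]_(r%:E) [modulus h])%E.
  move=> [_ /(_ _ hr)]; apply: le_trans.
  by apply: ereal_sup_ubound; exists t.
have [v [M0 M0S _]] : S !=set0.
  by apply/set0P/eqP => S0; move: Soo; rewrite S0 ereal_inf0.
have := Lnorm_ge0 (@leb R n) r%:E (modulus h).
move: H; rewrite -nuE lee_fin => H; rewrite le_eqVlt => /orP[/eqP nu0|nu0].
  by rewrite -nu0 mule0; have := H _ M0S; rewrite -nu0 mule0.
rewrite muleC -lee_pdivrMl//; apply: le_ereal_inf_tmp => _ [M MS <-].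
by rewrite lee_pdivrMl// muleC; exact: H.
Qed.

Lemma weak_op_norm_ge0 r U : (0 <= weak_op_norm r U)%E.
Proof. by apply: le_ereal_inf_tmp => _ [M [M0 _] <-]; rewrite lee_fin. Qed.

Lemma in_LpN p f : in_Lp p f -> in_Lp p (fun y => -1 * f y).
Proof.
move=> [[mRe mIm] foo]; split.
  split.
    rewrite (_ : (fun x => _) = (fun x => - complex.Re (f x))).
      exact: measurable_funN.
    by apply/funext => x; case: (f x) => a b /=; rewrite mulN1r oppr0 mul0r subr0.
  rewrite (_ : (fun x => _) = (fun x => - complex.Im (f x))).
    exact: measurable_funN.
  by apply/funext => x; case: (f x) => a b /=; rewrite mulN1r oppr0 mul0r addr0.
rewrite (_ : modulus _ = modulus f)//; apply/funext => x; congr EFin.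
by rewrite mulN1r; case: (f x) => a b /=; rewrite !sqrrN.
Qed.

Lemma sublinear_split U f1 f2 f3 : sublinear U ->
  in_Lp 1 f2 -> in_Lp 1 f3 -> f1 = (fun y => f2 y + f3 y) ->
  {ae leb, forall x, (`|U f1 x| <= `|U f2 x| + `|U f3 x|)%E}.
Proof. by move=> [sub _] L2 L3 ->; exact: sub. Qed.

(** Write [f3] as [f1 - f2] and use homogeneity with factor -1. This bounds the tail between two
    dilates by the two cut-off functions. *)
Lemma sublinear_splitN U f1 f2 f3 : sublinear U ->
  in_Lp 1 f1 -> in_Lp 1 f2 -> f1 = (fun y => f2 y + f3 y) ->
  {ae leb, forall x, (`|U f3 x| <= `|U f1 x| + `|U f2 x|)%E}.
Proof.
move=> [sub hom] L1 L2 E.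
have -> : f3 = (fun y => f1 y + (-1 * f2 y)).
  by apply/funext => y; rewrite E mulN1r addrAC subrr add0r.
apply: filterS2 (sub _ _ L1 (in_LpN L2)) (hom (-1) _ L2) => x H1 H2.
by rewrite (le_trans H1)// H2 /= sqrrN expr1n oppr0 expr0n/= addr0 sqrtr1 mul1e.
Qed.

Lemma cutoff_setD E E' f : E `<=` E' ->
  cutoff E' f = (fun y => cutoff E f y + cutoff (~` E) (cutoff E' f) y).
Proof.
move=> EE'; apply/funext => y; rewrite /cutoff in_setC.
have [yE|yE] := boolP (y \in E); rewrite /= ?add0r// addr0.
by rewrite ifT//; apply/mem_set/EE'/set_mem.
Qed.

(** For a negative [psi t], testing with the constant 1 makes the level set the whole unit cube,
    against [t < 1]. *)
Lemma W_property_ge0 q U psi (t : R) : (forall Q, 0 < vol Q) -> 1 <= q ->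
  W_property q U psi -> 0 < t < 1 -> 0 <= psi t.
Proof.
move=> vol_pos q1 [_ W] t01; rewrite leNgt; apply/negP => psi0.
have q0 : 0 < q by exact: lt_le_trans q1.
pose Q : cube R n := Cube (0 : Rn R n) (@ltr01 R).
pose f (x : Rn R n) : R[i] := 1.
have mf : cmeasurable f by split; exact: measurable_cst.
have f1 x : (modulus f x `^ q = 1)%E.
  by rewrite /modulus /f /= expr1n expr0n/= addr0 sqrtr1 powR1.
have I1 : (\int[leb]_(x in cube_set Q) modulus f x `^ q = (vol Q)%:E)%E.
  under eq_integral do rewrite f1.
  rewrite (integral_cst _ (@measurable_cube_set R n Q)) mul1e.
  exact: leb_cube_set.
have L : in_Lp q (cutoff (cube_set Q) f).
  apply: (in_Lp_cutoff q1 (lexx q)) => //.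
  - exact: measurable_cube_set.
  - by rewrite leb_cube_set ltry.
  - by rewrite I1 ltry.
have := W Q f t L t01.
have -> : average q Q f = 1%E.
  by rewrite averageE// I1 -EFinM mulVf ?gt_eqF//= powR1.
rewrite mule1.
rewrite (_ : [set x | _] = cube_set Q) ?leb_cube_set -?EFinM ?lee_fin.
  by apply/negP; rewrite -ltNge gtr_pMl// (andP t01).2.
apply/seteqP; split=> [x []//|x Qx]; split => //.
by apply: lt_le_trans (abse_ge0 _); rewrite lte_fin.
Qed.

End operators.

Lemma W_level_lt1 (R : realType) (n : nat) (alpha : R) : (1 <= alpha ->
  0 < (12 * (2 * alpha) ^+ n)^-1 < 1)%R.
Proof.
move=> a1; have K1 : (1 <= (2 * alpha) ^+ n)%R by rewrite exprn_ege1//; lra.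
have K12 : (1 < 12 * (2 * alpha) ^+ n)%R by lra.
by rewrite invr_gt0 invf_lt1 (lt_trans ltr01).
Qed.

Lemma step_const_le (R : realDomainType) (m k t v : R) :
  (0 <= m -> 0 <= k -> 0 <= t -> 0 <= v ->
  (2 + m) * t + k * v <= (2 + m + k) * (t + v) /\ t <= (2 + m + k) * (t + v))%R.
Proof.
move=> m0 k0 t0 v0; have := mulr_ge0 m0 t0; have := mulr_ge0 m0 v0.
by have := mulr_ge0 k0 t0; have := mulr_ge0 k0 v0; split; lra.
Qed.

Lemma child_const_le (R : realDomainType) (m k t v a b : R) :
  (0 <= t -> 0 <= a -> b <= m * a ->
  t * a + t * b + k * v * a <= ((2 + m) * t + k * v) * a)%R.
Proof.
by move=> t0 a0 /(ler_wpM2l t0); have := mulr_ge0 t0 a0; lra.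
Qed.

(** * The local step *)

Section local_step.
Local Open Scope ring_scope.
Context {R : realType} {n : nat}.
Variables (U : (Rn R n -> R[i]) -> Rn R n -> \bar R) (q r alpha : R) (psi : R -> R).
Variable f : Rn R n -> R[i].
Local Notation s := (Num.max q r).
Hypothesis vol_pos : forall Q : cube R n, 0 < vol Q.
Hypothesis n_gt0 : (0 < n)%N.
Hypothesis subU : sublinear U.
Hypothesis q_ge1 : 1 <= q.
Hypothesis r_ge1 : 1 <= r.
Hypothesis alpha_ge1 : 1 <= alpha.
Hypothesis WU : W_property q U psi.
Hypothesis weakU : weak_type r (sharp_maximal U alpha).
Hypothesis mf : cmeasurable f.
Hypothesis f_fin : (\int[leb]_x modulus f x `^ s < +oo)%E.
Implicit Types (Q P : cube R n) (x y : Rn R n).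

Let alpha_gt0 : 0 < alpha. Proof. exact: lt_le_trans alpha_ge1. Qed.

Definition dcube Q : cube R n := cdil alpha_gt0 Q.

Local Notation D Q := (dilate alpha Q).
Local Notation F A := (\int[leb]_(x in A) modulus f x `^ s)%E.

Let s_gt0 : 0 < s. Proof. by rewrite lt_max (lt_le_trans ltr01 q_ge1). Qed.
Let q_gt0 : 0 < q. Proof. exact: lt_le_trans q_ge1. Qed.
Let r_gt0 : 0 < r. Proof. exact: lt_le_trans r_ge1. Qed.
Let q_le_s : q <= s. Proof. by rewrite le_max lexx. Qed.
Let r_le_s : r <= s. Proof. by rewrite le_max lexx orbT. Qed.

Let K : R := (2 * alpha) ^+ n.
(* [osc_const] and [heavy_const] are chosen so that the exceptional sets
   [osc_exceptional Q] and [B] below have measures at most [2^-n vol Q / 96] and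
   [2^-n vol Q / 24]. *)
Definition osc_const : R := (96 * K) `^ r^-1.
Definition heavy_const : R := 24 * (6 * alpha) ^+ n.
Let lam : R := (12 * K)^-1.
Definition step_const : R := 2 + heavy_const `^ s^-1 + osc_const.
Local Notation kappa := osc_const.
Local Notation M := heavy_const.
Local Notation N := (weak_op_norm r (sharp_maximal U alpha)).

Let K_gt0 : 0 < K. Proof. by rewrite exprn_gt0// mulr_gt0. Qed.
Let KE : K = 2 ^+ n * alpha ^+ n. Proof. exact: exprMn. Qed.
Let M_gt0 : 0 < M. Proof. by rewrite mulr_gt0// exprn_gt0// mulr_gt0. Qed.
Let kappa_gt0 : 0 < kappa. Proof. by rewrite powR_gt0// mulr_gt0. Qed.

Let lam01 : 0 < lam < 1. Proof. exact: W_level_lt1. Qed.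

Let F_lty A : measurable A -> (F A < +oo)%E.
Proof.
move=> mA; apply: le_lt_trans f_fin; apply: (ge0_subset_integral _ mA measurableT).
- exact: measurable_modulus_poweR.
- by move=> x _; exact: poweR_ge0.
- exact: subsetT.
Qed.

Let Lp_cutoff p A : 1 <= p -> p <= s -> measurable A -> (leb A < +oo)%E ->
  in_Lp p (cutoff A f).
Proof. by move=> p1 ps mA Aoo; apply: (in_Lp_cutoff p1 ps) => //; exact: F_lty. Qed.

Let mD Q : measurable (D Q). Proof. exact: measurable_dilate. Qed.

Let D_lty Q : (leb (D Q) < +oo)%E. Proof. by rewrite leb_dilate// ltry. Qed.

Let hcube_D Q : hcube Q `<=` D Q.
Proof.
move=> x /hcube_sub_cube_set Qx i; apply: le_trans (Qx i) _.
by rewrite -!mulrA ler_pM2r// divr_gt0// side_gt0.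
Qed.

Let a Q : R := fine (average s (dcube Q) f).

Lemma average_dcube Q : average s (dcube Q) f = (a Q)%:E.
Proof.
rewrite /a fineK// ge0_fin_numE ?average_ge0// averageE//.
apply: poweR_lty; apply: lte_mul_pinfty => //; first by rewrite lee_fin invr_ge0 ltW.
by apply: F_lty; exact: measurable_cube_set.
Qed.

Let a_ge0 Q : 0 <= a Q. Proof. by rewrite fine_ge0// average_ge0. Qed.

Definition W_exceptional Q := [set x | D Q x /\
  (psi lam * a Q)%:E < `|U (cutoff (D Q) f) x|]%E.

Let psi_ge0 : 0 <= psi lam. Proof. exact: W_property_ge0 WU lam01. Qed.

Let leb_W Q : (leb (W_exceptional Q) <= (vol Q / (12 * 2 ^+ n))%:E)%E.
Proof.
have L : in_Lp q (cutoff (cube_set (dcube Q)) f).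
  by rewrite cube_set_cdil; apply: Lp_cutoff.
apply: le_trans (le_trans (WU.2 (dcube Q) f lam L lam01) _).
  apply: le_leb => x [Qx Ux]; rewrite /= cube_set_cdil; split => //.
  apply: le_lt_trans Ux; rewrite EFinM -average_dcube.
  by apply: lee_wpmul2l; rewrite ?lee_fin//; exact: average_mono.
rewrite leb_cube_set vol_cdil -EFinM lee_fin /lam KE le_eqVlt.
by apply/orP; left; apply/eqP; field; rewrite !gt_eqF ?exprn_gt0.
Qed.

Let N_fin : (fine N)%:E = N.
Proof. by rewrite fineK// ge0_fin_numE ?weak_op_norm_ge0. Qed.

Let N_ge0 : 0 <= fine N. Proof. by rewrite fine_ge0// weak_op_norm_ge0. Qed.

Definition osc_exceptional Q := [set x |
  (kappa * fine N * a Q)%:E < `|sharp_maximal U alpha (cutoff (D Q) f) x|]%E.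

Let sharp_level Q (t : R) : 0 < t ->
  (t%:E * leb [set x | t%:E < `|sharp_maximal U alpha (cutoff (D Q) f) x|] `^ r^-1 <=
   (fine N * a Q * (alpha ^+ n * vol Q) `^ r^-1)%:E)%E.
Proof.
move=> t0; apply: le_trans (weak_op_bound t0 weakU _) _.
  exact: Lp_cutoff.
rewrite -N_fin -mulrA EFinM; apply: lee_wpmul2l; first by rewrite lee_fin.
rewrite Lnorm_cutoff// EFinM -average_dcube muleC.
have V0 : 0 < alpha ^+ n * vol Q by rewrite mulr_gt0// exprn_gt0.
set X := (\int[leb]_(x in D Q) modulus f x `^ r)%E.
have X0 : (0 <= X)%E by apply: integral_ge0 => x _; exact: poweR_ge0.
apply: le_trans (lee_wpmul2l _ (average_mono _ r_gt0 r_le_s mf)) => //.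
  rewrite averageE// cube_set_cdil vol_cdil -/X -poweR_EFin -poweRM//.
  - by rewrite muleA -EFinM divff ?gt_eqF// mul1e.
  - by rewrite lee_fin ltW.
  - by rewrite mule_ge0// lee_fin invr_ge0 ltW.
by rewrite lee_fin powR_ge0.
Qed.

(** Dividing [sharp_level] by the level leaves [kappa^-1] times the [r]-th root of the volume of the
    dilate, and [kappa ^ r = 96 K]. *)
Let leb_osc Q : (leb (osc_exceptional Q) <= (vol Q / (96 * 2 ^+ n))%:E)%E.
Proof.
have an0 : 0 < alpha ^+ n by rewrite exprn_gt0.
have V0 : 0 < alpha ^+ n * vol Q by rewrite mulr_gt0.
have Na0 : 0 <= fine N * a Q by rewrite mulr_ge0.
have rV0 : 0 < r^-1 by rewrite invr_gt0.
(* If the level is zero, the weak bound does not apply to it directly; the set is exhausted by the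
   levels [1 / (k + 1)], each giving a null set. *)
rewrite /osc_exceptional; move: Na0; rewrite le_eqVlt => /orP[/eqP Na0|Na0].
  rewrite -mulrA -Na0 mulr0.
  apply: (@le_trans _ _ 0%E); last by rewrite lee_fin divr_ge0 ?ltW// mulr_gt0// exprn_gt0.
  pose B k := [set x |
    ((k.+1%:R^-1 : R)%:E < `|sharp_maximal U alpha (cutoff (D Q) f) x|)%E].
  apply: (@le_trans _ _ (leb (\bigcup_k B k))).
    apply: le_leb => x /=; rewrite /B.
    case xE: (`|_|)%E => [z||]//; rewrite ?lte_fin => z0; last first.
      by exists 0%N => //=; rewrite xE ltry.
    exists (Num.truncn z^-1) => //=; rewrite xE lte_fin -[ltRHS]invrK ltf_pV2 ?posrE ?invr_gt0//.
    exact: truncnS_gt.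
  apply: le_trans (leb_bigcup_le _) _; rewrite eseries0// => k _ _.
  have t0 : 0 < (k.+1%:R^-1 : R) by rewrite invr_gt0.
  have := sharp_level Q t0; rewrite -Na0 mul0r pmule_rle0 ?lte_fin//.
  rewrite -/(B k) => H; apply: (@poweR_eq0_eq0 _ _ r^-1 (leb_ge0 _)).
  by apply/eqP; rewrite eq_le H poweR_ge0.
have t0 : 0 < kappa * fine N * a Q by rewrite -mulrA mulr_gt0.
have := sharp_level Q t0; set y := leb _; have y0 : (0 <= y)%E by exact: leb_ge0.
rewrite -lee_pdivlMl// -EFinM => H.
have H2 : (y `^ r^-1 <= ((vol Q / (96 * 2 ^+ n)) `^ r^-1)%:E)%E.
  apply: le_trans H _; rewrite lee_fin.
  rewrite (_ : vol Q / _ = (96 * K)^-1 * (alpha ^+ n * vol Q)); last first.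
    by rewrite KE; field; rewrite !gt_eqF ?exprn_gt0.
  have K96 : 0 <= 96 * K by rewrite mulr_ge0// ltW.
  have kE : (96 * K)^-1 `^ r^-1 = kappa^-1.
    by rewrite -(powR_inv1 K96) powRAC powR_inv1// powR_ge0.
  move: (alpha ^+ n * vol Q) V0 => v v0.
  rewrite (powRM _ _ (ltW v0)) ?invr_ge0// kE.
  rewrite le_eqVlt; apply/orP; left; apply/eqP.
  have /andP[N0 a0] : (fine N != 0) && (a Q != 0).
    by apply/andP; split; apply: contraTneq Na0 => ->; rewrite ?mul0r ?mulr0 ltxx.
  by field; rewrite N0 a0 gt_eqF.
have W0 : 0 <= vol Q / (96 * 2 ^+ n) by rewrite divr_ge0 ?ltW// mulr_gt0// exprn_gt0.
move: (vol Q / _) H2 W0 => w H2 W0.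
rewrite -[y]poweRe1// -[w]powRr1//.
rewrite -(mulVf (lt0r_neq0 r_gt0)) powRrM poweRrM -poweR_EFin.
apply: gt0_ler_poweR => //; first exact: ltW.
- by rewrite in_itv/= poweR_ge0 leey.
- by rewrite in_itv/= lee_fin powR_ge0 leey.
Qed.

Let light_average Q P : ~ heavy (fun x => modulus f x `^ s)%E alpha M Q P ->
  a P <= M `^ s^-1 * a Q.
Proof.
have m0 := ltW M_gt0; set m := M in m0 *; clearbody m.
move=> /negP; rewrite -leNgt.
have an0 : 0 < alpha ^+ n by rewrite exprn_gt0.
have FE P' : F (D P') = (fine (F (D P')))%:E.
  by rewrite fineK// ge0_fin_numE ?F_lty// integral_ge0// => x _; exact: poweR_ge0.
have F0 P' : 0 <= fine (F (D P')).
  by rewrite fine_ge0// integral_ge0// => x _; exact: poweR_ge0.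
have aE P' : a P' = ((alpha ^+ n * vol P')^-1 * fine (F (D P'))) `^ s^-1.
  apply: EFin_inj; rewrite -average_dcube averageE// vol_cdil cube_set_cdil.
  by rewrite FE -EFinM poweR_EFin.
rewrite (FE P) (FE Q) -!EFinM lee_fin => H.
have V0 P' : 0 < alpha ^+ n * vol P' by rewrite mulr_gt0.
rewrite !aE -powRM ?mulr_ge0 ?invr_ge0//; last by rewrite ltW.
- have V0' P' := ltW (V0 P').
  apply: ge0_ler_powR; rewrite ?nnegrE ?mulr_ge0 ?invr_ge0//; first exact: ltW.
  rewrite ler_pdivrMl//.
  rewrite [leRHS](_ : _ = (m * vol P * fine (F (D Q))) / vol Q); last first.
    by field; rewrite !gt_eqF.
  by rewrite ler_pdivlMr// mulrC.
Qed.

Lemma local_step Q : exists S : set (cube R n), [/\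
  forall P, S P -> cells Q P /\ side P < side Q, trivIset S hcube,
  (leb (\bigcup_(P in S) hcube P) <= (vol Q / 2)%:E)%E &
  leb.-negligible [set x | ~ (hcube Q x ->
    ((forall P, S P -> ~ hcube P x) ->
      (`|U (cutoff (D Q) f) x| <=
        (step_const * (psi lam + fine N))%:E * average s (dcube Q) f)%E) /\
    (forall P, S P -> hcube P x ->
      (`|U (cutoff (D Q) f) x| <=
        (step_const * (psi lam + fine N))%:E * average s (dcube Q) f +
        `|U (cutoff (D P) f) x|)%E))]].
Proof.
have n2 : 0 < 2 ^+ n :> R by rewrite exprn_gt0.
pose E1 := W_exceptional Q; pose E2 := osc_exceptional Q.
have lebE12 : (leb (E1 `|` E2) <= (vol Q / 2 ^+ n * (3 / 32))%:E)%E.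
  apply: le_trans (lebU_le _ _) _; apply: le_trans (leeD (leb_W Q) (leb_osc Q)) _.
  rewrite -EFinD lee_fin le_eqVlt; apply/orP; left; apply/eqP.
  by field; rewrite gt_eqF.
(* In units of [2^-n vol Q / 96]: [E1] and [E2] contribute 8 + 1, the margin 1, doubling gives 20,
   and [B] adds 4. The total 24 is a quarter of [2^-n vol Q]. *)
have d0 : 0 < vol Q / 2 ^+ n / 96 by rewrite !divr_gt0.
have [V [mV lebV EV]] := leb_neighborhood n_gt0 d0 (le_lt_trans lebE12 (ltry _)).
pose B := \bigcup_(P in [set P | cells Q P /\
  heavy (fun x => modulus f x `^ s)%E alpha M Q P]) hcube P.
have mB : measurable B.
  apply: countable_bigcup_measurable => [|P _]; last exact: measurable_hcube.
  apply: sub_countable (countable_cells Q); apply: subset_card_le.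
  by move=> P [].
have lebB : (leb B <= (vol Q / 2 ^+ n / 24)%:E)%E.
  have h0 x : (0 <= modulus f x `^ s)%E by exact: poweR_ge0.
  apply: le_trans (leb_heavy_cells (measurable_modulus_poweR s mf) h0 vol_pos
    alpha_ge1 M_gt0 (F_lty (mD Q))) _.
  rewrite lee_fin /heavy_const (_ : 6 * alpha = 2 * (3 * alpha)); last by ring.
  rewrite [(2 * (3 * alpha)) ^+ n]exprMn le_eqVlt; apply/orP; left; apply/eqP.
  have : (3 * alpha) ^+ n != 0 by rewrite gt_eqF// exprn_gt0// mulr_gt0.
  by set c := (_ ^+ n) => c0; field; rewrite ?c0 ?gt_eqF.
pose O := V `|` B.
have mO : measurable O by exact: measurableU.
have lebO : (leb O <= (vol Q / 2 ^+ n.+2)%:E)%E.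
  apply: le_trans (lebU_le _ _) _.
  apply: le_trans (leeD (le_trans lebV (lee_wpmul2l _ (leeD2r _ lebE12))) lebB) _.
    by rewrite lee_fin.
  have -> : (2%:E * ((vol Q / 2 ^+ n * (3 / 32))%:E + (vol Q / 2 ^+ n / 96)%:E) +
      (vol Q / 2 ^+ n / 24)%:E = (2 * (vol Q / 2 ^+ n * (3 / 32) +
      vol Q / 2 ^+ n / 96) + vol Q / 2 ^+ n / 24)%:E)%E by [].
  rewrite lee_fin le_eqVlt; apply/orP; left; apply/eqP.
  by rewrite !exprS; field; rewrite gt_eqF.
have EO x : (E1 `|` E2 `|` B) x -> hcube Q x ->
    exists k, hcube (dyadic Q k x) `<=` O.
  move=> [/EV[e e0 He] Qx|[P [QP hP] Px] Qx].
    have [k Hk] := dyadic_small Qx e0; exists k => y ky; left.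
    by apply: He => i; exact: Hk.
  have [k kE] := cells_dyadic_eq QP Px.
  by exists k; rewrite -kE => y Py; right; exists P.
have EsubO : E1 `|` E2 `|` B `<=` O.
  move=> x [/EV[e e0 He]|Bx]; [left; apply: He => i|by right].
  by rewrite subrr normr0.
have [S [S1 S2 S3 S4]] := stopping_cells vol_pos mO lebO EO.
have [Cpsi CN] : (2 + M `^ s^-1) * psi lam + kappa * fine N <=
    step_const * (psi lam + fine N) /\ psi lam <= step_const * (psi lam + fine N).
  by apply: step_const_le => //; [exact: powR_ge0|exact: ltW].
exists S; split => //.
  by move=> P /S1[].
apply: (@negligibleS _ _ _ _ (\bigcup_(P in S) [set x | ~ (hcube P x ->
    (`|U (cutoff (D Q) f) x| <=
        (step_const * (psi lam + fine N))%:E * average s (dcube Q) f +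
        `|U (cutoff (D P) f) x|)%E)])).
  move=> x /not_implyP[Qx /not_andP[nc|]]; last first.
    by move=> /existsNP[P /not_implyP[SP nP]]; exists P.
  (* A point outside all stopping cubes avoids [E1], so the first bound holds there without
     exception. *)
  exfalso; apply: nc => noch; rewrite leNgt; apply/negP => lt.
  suff /(S4 x Qx)[P SP Px] : (E1 `|` E2 `|` B) x by exact: noch SP Px.
  left; left; split; first exact: hcube_D.
  apply: le_lt_trans lt; rewrite average_dcube -EFinM lee_fin.
  exact: ler_wpM2r.
apply: negligible_countable.
  apply: sub_countable (countable_cells Q); apply: subset_card_le.
  by move=> P /S1[].
move=> P SP; have [cQP _ OP] := S1 _ SP.
have Dsub : D P `<=` D Q by exact: dilate_cells.
set fQ := cutoff (D Q) f; set fP := cutoff (D P) f.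
pose fQP := cutoff (~` D P) fQ.
have fE : fQ = (fun y => fP y + fQP y) by exact: cutoff_setD.
have s1 : 1 <= s by exact: le_trans q_le_s.
have LQ : in_Lp 1 fQ by exact: Lp_cutoff.
have LP : in_Lp 1 fP by exact: Lp_cutoff.
have LQP : in_Lp 1 fQP.
  rewrite (_ : fQP = cutoff (~` D P `&` D Q) f); last first.
    by apply/funext => y; rewrite /fQP /fQ /cutoff in_setI; case: (y \in ~` _).
  apply: Lp_cutoff => //; first by apply: measurableI => //; exact: measurableC.
  by apply: le_lt_trans (D_lty Q); apply: le_leb; exact: subIsetr.
have split1 := sublinear_split subU LP LQP fE.
have /negligible_leb0 split2 := sublinear_splitN subU LQ LP fE.
set NB := (X in leb X = _) in split2.
(* [O] takes at most half of [P], [W_exceptional P] at most a twelfth, and [NB] is null; so [G] has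
   positive outer measure. *)
pose G := hcube P `\` (O `|` W_exceptional P `|` NB).
have G0 : (0 < leb G)%E.
  rewrite lt_neqAle leb_ge0 andbT; apply/eqP => G0.
  have : (leb (hcube P) <= leb (hcube P `&` O) + leb (W_exceptional P))%E.
    apply: (@le_trans _ _ (leb ((hcube P `&` O) `|` W_exceptional P `|` (NB `|` G)))).
      apply: le_leb => x Px.
      have [Ox|Ox] := pselect (O x); first by left; left.
      have [Wx|Wx] := pselect (W_exceptional P x); first by left; right.
      have [Nx|Nx] := pselect (NB x); first by right; left.
      by right; right; split => // -[[]|].
    apply: le_trans (lebU_le _ _) _; rewrite -[leRHS]adde0.
    apply: leeD; first exact: lebU_le.
    by apply: le_trans (lebU_le _ _) _; rewrite split2 -G0 adde0.
  move=> H; have := le_trans H (leeD OP (leb_W P)).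
  rewrite leb_hcube -EFinD lee_fin; apply/negP; rewrite -ltNge.
  have n1 : (1 : R) <= 2 ^+ n by rewrite exprn_ege1// ler1n.
  have : vol P / (12 * 2 ^+ n) <= vol P / 12.
    by rewrite ler_pM2l// lef_pV2 ?posrE ?mulr_gt0//; lra.
  by have := vol_pos P; lra.
have [x0 [P0 /not_orP[/not_orP[nO0 _] _]]] : G !=set0.
  by apply/set0P/eqP => GE; move: G0; rewrite GE measure0 ltxx.
have nEB x : ~ O x -> ~ W_exceptional Q x /\ ~ osc_exceptional Q x /\ ~ B x.
  move=> nO; split; [|split] => H; apply: nO; apply: EsubO.
  - by left; left.
  - by left; right.
  - by right.
have aPQ : a P <= M `^ s^-1 * a Q.
  apply: light_average => hP; have [_ [_ nB]] := nEB _ nO0.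
  by apply: nB; exists P.
pose A := psi lam * a Q + psi lam * a P.
have GA x : G x -> (`|U fQP x| <= A%:E)%E.
  move=> [Px /not_orP[/not_orP[/nEB[nWQ _] nWP] /contrapT nNB]].
  apply: le_trans nNB _; rewrite /A EFinD; apply: leeD.
  - rewrite leNgt; apply/negP => H; apply: nWQ; split => //.
    exact/hcube_D/(hcube_cells cQP).
  - by rewrite leNgt; apply/negP => H; apply: nWP; split => //; exact: hcube_D.
(* [P] is one of the cubes in the supremum defining the sharp function of [fQ] at [x0], with tail
   exactly [fQP], and [x0] lies outside [osc_exceptional Q]. *)
have osc : (ess_osc P (U fQP) <= (kappa * fine N * a Q)%:E)%E.
  have [_ [nosc _]] := nEB _ nO0.
  apply: (@le_trans _ _ `|sharp_maximal U alpha fQ x0|%E); last first.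
    by rewrite leNgt; apply/negP.
  apply: le_trans (lee_abs _); apply: ereal_sup_ubound.
  by exists P => //; exact: hcube_sub_cube_set.
have GP : (0 < leb (G `&` cube_set P))%E.
  by rewrite setIidl// => x [Px _]; exact: hcube_sub_cube_set.
apply: negligibleS (_ : leb.-negligible (~` [set x | (`|U fQ x| <= `|U fP x| + `|U fQP x|)%E /\
    (cube_set P x -> (`|U fQP x| <= (A + kappa * fine N * a Q)%:E)%E)])); last first.
  exact: filterI split1 (ae_oscillation osc GP GA).
move=> x /= nx [H1 H2]; apply: nx => Px.
apply: le_trans H1 _; rewrite addeC; apply: leeD => //.
apply: le_trans (H2 (hcube_sub_cube_set Px)) _.
rewrite average_dcube -EFinM lee_fin.
by apply: le_trans (child_const_le kappa (fine N) psi_ge0 (a_ge0 Q) aPQ) _; exact: ler_wpM2r.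
Qed.

End local_step.

(** * From the local step to the sparse bound *)

Lemma compact_supp_hcube (R : realType) (n : nat) (f : Rn R n -> R[i]) :
  compact (supp f) -> exists Q : cube R n, forall x, f x != 0%R -> hcube Q x.
Proof.
move=> /compact_bounded[M0 [_ HM]].
pose M := (`|M0| + 1)%R.
have M0M : (M0 < M)%R by rewrite (le_lt_trans (ler_norm _))// ltrDl.
have M1 : (0 < 2 * (M + 1))%R by rewrite mulr_gt0// /M; have := normr_ge0 M0; lra.
exists (Cube (0%R : Rn R n) M1) => x fx i /=.
have /= xM : (`|x| <= M)%R by apply: (HM M M0M); exact: subset_closure.
have xi : (`|x 0%R i| <= M)%R.
  apply: le_trans xM; rewrite [leRHS]mx_normrE.
  exact: (le_bigmax_cond _ (fun ij => `|x ij.1 ij.2|%R) (j := (0%R, i))).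
move: xi; rewrite mxE ler_norml => /andP[a b].
by apply/andP; split; lra.
Qed.

(* Nothing so far excludes that [leb] vanishes identically, as only the upper
   bound of the measure of a box has been needed; but then every statement holds
   almost everywhere. *)
Lemma negligible_or_volume (R : realType) (n : nat) :
  (forall X : set (Rn R n), leb.-negligible X) \/ forall Q : cube R n, (0 < vol Q)%R.
Proof.
have [T0|T0] := leP (leb [set: Rn R n]) 0; [left|right] => X; last exact: vol_gt0.
by apply: leb0_negligible; apply: le_trans T0; exact: le_leb.
Qed.

Theorem theorem2p2 (R : realType) :
  exists c : nat -> R -> R -> R -> R,
  forall (n : nat) (T : (Rn R n -> R[i]) -> Rn R n -> R[i])
         (A : Type) (phi : A -> Rn R n -> R) (q r alpha : R) (psi : R -> R),
  let TF := max_modulated T phi in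
  let s := Num.max q r in
    (0 < n)%N ->
    singular_integral T ->
    inhabited A -> (forall a, measurable_fun setT (phi a)) ->
    sublinear TF ->
    (1 <= q)%R -> (1 <= r)%R -> (3 <= alpha)%R ->
    W_property q TF psi ->
    weak_type r (sharp_maximal TF alpha) ->
  forall f : Rn R n -> R[i],
    in_Lp s f -> compact (supp f) ->
  exists S : set (cube R n),
    sparse (2 * alpha ^+ n)^-1%R S /\
    {ae leb, forall x,
      `|TF f x| <=
      (c n r s alpha)%:E *
      ((psi (12 * (2 * alpha) ^+ n)^-1%R)%:E +
       weak_op_norm r (sharp_maximal TF alpha)) *
      \esum_(Q in S) (average s Q f * (\1_(cube_set Q) x)%:E)}.
Proof.
(* This is [step_const] written out; [q] enters it only through [s]. *)
exists (fun n r s alpha =>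
  2 + (24 * (6 * alpha) ^+ n) `^ s^-1 + (96 * (2 * alpha) ^+ n) `^ r^-1)%R.
move=> n T A phi q r alpha psi TF s n0 _ _ _ subT q1 r1 a3 WT weakT f [mf foo] cf.
have [null|vol_pos] := negligible_or_volume R n.
  exists set0; split; last exact: null.
  by exists (fun=> set0); split => // Q Q' [].
have a1 : (1 <= alpha)%R by apply: le_trans a3; rewrite ler1n.
have a0 : (0 < alpha)%R by exact: lt_le_trans a1.
have s0 : (0 < s)%R by rewrite lt_max (lt_le_trans _ q1).
have f_fin : \int[leb]_x modulus f x `^ s < +oo.
  move: foo; rewrite unlock => /lty_poweRy; rewrite invr_neq0 ?gt_eqF// => /(_ isT).
  by under eq_integral do rewrite gee0_abs ?modulus_ge0//.
have [J0 fJ0] := compact_supp_hcube cf.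
have [roots [rC rT rcov rJ]] := root_partition J0.
have [ch chP] := choice (local_step vol_pos n0 subT q1 r1 a1 WT weakT mf f_fin).
have ch_cells Q P : ch Q P -> cells Q P /\ (side P < side Q)%R.
  by have [H _ _ _] := chP Q; exact: H.
have ch_triv Q : trivIset (ch Q) hcube by have [] := chP Q.
have ch_half Q : leb (\bigcup_(P in ch Q) hcube P) <= (vol Q / 2)%:E.
  by have [] := chP Q.
pose N := fine (weak_op_norm r (sharp_maximal TF alpha)).
have NE : weak_op_norm r (sharp_maximal TF alpha) = N%:E.
  by rewrite fineK// ge0_fin_numE ?weak_op_norm_ge0.
have psi0 : (0 <= psi (12 * (2 * alpha) ^+ n)^-1)%R.
  exact: W_property_ge0 WT (W_level_lt1 n a1).
pose C := (@step_const R n q r alpha * (psi (12 * (2 * alpha) ^+ n)^-1 + N))%R.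
have C0 : (0 <= C)%R.
  rewrite mulr_ge0 ?addr_ge0 ?powR_ge0//.
  by rewrite fine_ge0// weak_op_norm_ge0.
have iter := sparse_iteration ch_cells ch_triv ch_half rC C0
  (fun Q => average_ge0 s (dcube a1 Q) f)
  (fun Q => let: And4 _ _ _ H := chP Q in H).
exists (dcube a1 @` nodes ch roots); split.
  have ai : (0 < alpha^-1)%R by rewrite invr_gt0.
  have dK Q : cdil ai (dcube a1 Q) = Q.
    by apply: cubeP => //=; rewrite mulKf// gt_eqF.
  (* Members of the family are dilated nodes; shrinking by the inverse factor recovers the node and
     its kept part. Half of a node is the fraction [(2 * alpha ^+ n)^-1] of its dilate. *)
  exists (fun Q => kept ch (cdil ai Q)); split.
    move=> _ _ [Q nQ <-] [Q' nQ' <-]; rewrite !dK => H; congr dcube.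
    exact: (trivIset_kept ch_cells ch_triv rT nQ nQ' H).
  move=> _ [Q nQ <-]; rewrite dK; split.
  - exact: measurable_kept.
  - move=> x [/hcube_sub_cube_set Qx _] i; apply: le_trans (Qx i) _ => /=.
    by rewrite !mul1r ler_pM2r// ler_peMl// ltW// side_gt0.
  - apply: le_trans (leb_kept ch_half Q).
    rewrite leb_cube_set vol_cdil -EFinM lee_fin le_eqVlt; apply/orP; left; apply/eqP.
    have : (alpha ^+ n != 0)%R by rewrite gt_eqF// exprn_gt0.
    by move=> ?; field.
apply: negligibleS iter => x /= nx.
have [Q rQ Qx] := rcov x; exists Q; split => // H; apply: nx.
(* Here [alpha >= 3] enters: the support of [f] lies in [J0], hence in the triple of every root. *)
have fE : cutoff (dilate alpha Q) f = f.
  apply/funext => y; rewrite /cutoff; case: ifPn => // yQ; apply/esym/eqP.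
  apply: contraNT yQ => /fJ0/(rJ _ rQ) y3; apply/mem_set => i.
  by apply: le_trans (y3 i) _; rewrite !ler_pM2r// side_gt0.
move: H; rewrite fE => H; apply: le_trans H _.
rewrite NE -EFinD -EFinM; apply: lee_wpmul2l; first by rewrite lee_fin.
rewrite esum_image; last by move=> P P' _ _; exact: cdil_inj.
apply: le_esum => P _; apply: lee_wpmul2l; first exact: average_ge0.
rewrite lee_fin !indicE ler_nat; case: (boolP (x \in hcube P)) => // /set_mem Px.
rewrite mem_set//= => i; apply: le_trans (hcube_sub_cube_set Px i) _.
by rewrite !mul1r ler_pM2r// ler_peMl// ltW// side_gt0.
Qed.
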